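(* Fix an integer $m\ge2$, let $k=2m$, and let $X_k$ be the $(2,k,\infty)$ Hecke surface. Then $$\frac{\big|\{\gamma\subset X_k \text{ a reciprocal geodesic based at the order } k \text{ cone point}: |\gamma|=2t\}\big|}{\beta_{2m}^{t}}\xrightarrow{t\to\infty}\frac{e_{2m}}{2},$$ where $e_{2m}$ is a positive constant (the specific coefficient defined in the context) and $\beta_{2m}$ is the unique positive root of the polynomial $$x^{m+1}-2x^{m-1}-2x^{m-2}-\dots-2x-1 .$$ The same asymptotic statement (same base, same limit) holds for the primitive reciprocal geodesics based at the order $k$ cone point.
   Context: Let $k=2m$ with $m\ge 2$ and $G=\mathbb{Z}_2*\mathbb{Z}_k$, with $a$ the generator of $\mathbb{Z}_2$ and $b$ the generator of $\mathbb{Z}_k$. The Hecke group $\Gamma_k\subset \mathrm{PSL}(2,\mathbb{R})$ is the image of $G$ under the discrete faithful representation $a\mapsto A=\begin{pmatrix}0&-1\\1&0\end{pmatrix}$, $b\mapsto B=\begin{pmatrix}0&-1\\1&2\cos(\pi/k)\end{pmatrix}$, and $X_k=\mathbb{H}/\Gamma_k$ is the $(2,k,\infty)$ Hecke surface. Its order $k$ cone point is the projection of the fixed point of $B$. A reciprocal geodesic based at the order $k=2m$ cone point is (i.e. corresponds to) the conjugacy class in $G\cong\Gamma_k$ of an element that is a product of two distinct involutions, both conjugate to $b^m$; such an element is automatically hyperbolic. Geodesics are counted as conjugacy classes. The word length $|g|$ of $g\in G$ is with respect to $\{a,b,b^{-1}\}$. The length $|\gamma|$ of a reciprocal geodesic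 $\gamma$ corresponding to a conjugacy class $[g]$ is $|[g]|=\min\{|h|: h\in[g]\}$. An element $g\in G$ is primitive if it is not a non-trivial power of another element of $G$; a reciprocal geodesic is primitive if the elements of its conjugacy class are primitive. Constant. Let $E_k=\{l\in\mathbb{Z}\setminus\{0\}: -m+1\le l\le m\}$. An $(aa)$-word is an element $ab^{x_0}ab^{x_1}\cdots ab^{x_{n-1}}a$ with $n\ge0$ and all $x_i\in E_k$ (for $n=0$ it is $a$). Let $\mathcal{N}_{2t}$ be the set of elements $[b^m,h]=b^mhb^{-m}h^{-1}$, $h$ an $(aa)$-word, with $|[b^m,h]|=2t$ (word length). The sequence $|\mathcal{N}_{2t}|$, $t\ge 3$, satisfies a linear recurrence with characteristic polynomial $x^{m+1}-2x^{m-1}-\dots-2x-1$. This polynomial has $m+1$ distinct complex roots $\lambda_0,\dots,\lambda_m$, where $\lambda_0=\beta_{2m}$ is the unique positive root. Thus there are unique constants $a_0,\dots,a_m$ with $|\mathcal{N}_{2t}|=\sum_{i=0}^m a_i\lambda_i^t$ for all $t\ge 3$. The constant $e_{2m}$ is $a_0$. *)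

(* Defs.v *)
From HB Require Import structures.
From mathcomp Require Import all_boot all_order all_algebra all_fingroup.
From mathcomp Require Import generic_quotient finmap complex.
From mathcomp Require Import all_classical all_reals all_analysis.
Set Implicit Arguments.
Unset Strict Implicit.
Unset Printing Implicit Defensive.
Import Order.TTheory GRing.Theory Num.Theory.
Import numFieldNormedType.Exports.
Local Open Scope classical_set_scope.
Local Open Scope ring_scope.

(** The free product [G * H]: words in the letters of [G] and [H], modulo the
    smallest congruence for concatenation that evaluates products inside [G]
    and [H] and erases their units. *)

Inductive fp_equiv (G H : groupType) : seq (G + H) -> seq (G + H) -> Prop :=
| fp_refl u : fp_equiv u u
| fp_sym u v : fp_equiv u v -> fp_equiv v u
| fp_trans u v w : fp_equiv u v -> fp_equiv v w -> fp_equiv u w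
| fp_cat u u' v v' :
    fp_equiv u u' -> fp_equiv v v' -> fp_equiv (u ++ v) (u' ++ v')
| fp_mull x y : fp_equiv [:: inl x; inl y] [:: inl (x * y)%g]
| fp_mulr x y : fp_equiv [:: inr x; inr y] [:: inr (x * y)%g]
| fp_onel : fp_equiv [:: inl 1%g] [::]
| fp_oner : fp_equiv [:: inr 1%g] [::].

Definition fp_rel (G H : groupType) : rel (seq (G + H)) :=
  fun u v => `[< fp_equiv u v >].

Lemma fp_rel_refl (G H : groupType) : reflexive (@fp_rel G H).
Proof. by move=> u; apply/asboolP; exact: fp_refl. Qed.

Lemma fp_rel_sym (G H : groupType) : symmetric (@fp_rel G H).
Proof. by move=> u v; apply/asboolP/asboolP; exact: fp_sym. Qed.

Lemma fp_rel_trans (G H : groupType) : transitive (@fp_rel G H).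
Proof.
by move=> v u w /asboolP uv /asboolP vw; apply/asboolP; exact: fp_trans uv vw.
Qed.

Canonical fp_equiv_rel (G H : groupType) :=
  EquivRel (@fp_rel G H) (@fp_rel_refl G H) (@fp_rel_sym G H)
    (@fp_rel_trans G H).

Definition free_prod (G H : groupType) : Type :=
  {eq_quot (fp_equiv_rel G H)}%qT.

HB.instance Definition _ (G H : groupType) := Choice.on (free_prod G H).
HB.instance Definition _ (G H : groupType) := EqQuotient.on (free_prod G H).

Section FreeProd.
Variables G H : groupType.
Local Notation word := (seq (G + H)).
Local Notation FP := (free_prod G H).

Lemma fp_piP (u v : word) : fp_equiv u v <-> \pi_FP%qT u = \pi_FP%qT v.
Proof.
split=> [uv|/eqquotP /= /asboolP //].
by apply/eqquotP; apply/asboolP.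
Qed.

Lemma fp_reprP (u : word) : fp_equiv (repr (\pi_FP%qT u)) u.
Proof. by apply/fp_piP; rewrite reprK. Qed.

Definition inv_letter (x : G + H) : G + H :=
  match x with inl g => inl g^-1%g | inr h => inr h^-1%g end.

Definition inv_word (u : word) : word := rev (map inv_letter u).

Definition fp_mul (x y : FP) : FP := \pi_FP%qT (repr x ++ repr y).
Definition fp_one : FP := \pi_FP%qT [::].
Definition fp_inv (x : FP) : FP := \pi_FP%qT (inv_word (repr x)).

Lemma fp_mul_pi (u v : word) :
  fp_mul (\pi_FP%qT u) (\pi_FP%qT v) = \pi_FP%qT (u ++ v).
Proof. by apply/fp_piP; apply: fp_cat; exact: fp_reprP. Qed.

Lemma fp_inv_word (u v : word) :
  fp_equiv u v -> fp_equiv (inv_word u) (inv_word v).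
Proof.
rewrite /inv_word; elim=> {u v} /=.
- by move=> u; exact: fp_refl.
- by move=> u v _; exact: fp_sym.
- by move=> u v w _ uv _; exact: fp_trans.
- by move=> u u' v v' _ uu' _ vv'; rewrite !map_cat !rev_cat; exact: fp_cat.
- by move=> x y; rewrite /rev /= invgM; exact: fp_mull.
- by move=> x y; rewrite /rev /= invgM; exact: fp_mulr.
- by rewrite /rev /= invg1; exact: fp_onel.
- by rewrite /rev /= invg1; exact: fp_oner.
Qed.

Lemma fp_inv_pi (u : word) : fp_inv (\pi_FP%qT u) = \pi_FP%qT (inv_word u).
Proof. by apply/fp_piP; apply: fp_inv_word; exact: fp_reprP. Qed.

Lemma fp_letterV (x : G + H) : fp_equiv [:: inv_letter x; x] [::].
Proof.
case: x => x /=.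
- by apply: fp_trans (fp_mull _ _ _) _; rewrite mulVg; exact: fp_onel.
- by apply: fp_trans (fp_mulr _ _ _) _; rewrite mulVg; exact: fp_oner.
Qed.

Lemma fp_wordV (u : word) : fp_equiv (inv_word u ++ u) [::].
Proof.
elim: u => [|x u IHu]; first exact: fp_refl.
rewrite /inv_word map_cons rev_cons cat_rcons -/(inv_word u).
apply: fp_trans IHu; apply: fp_cat; first exact: fp_refl.
rewrite -[inv_letter x :: _]/([:: inv_letter x; x] ++ u) -[X in fp_equiv _ X]cat0s.
by apply: fp_cat; [exact: fp_letterV|exact: fp_refl].
Qed.

Lemma fp_mulA : associative fp_mul.
Proof.
move=> x y z; rewrite -[x]reprK -[y]reprK -[z]reprK.
rewrite (fp_mul_pi (repr y)) (fp_mul_pi (repr x) (repr y)).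
by rewrite (fp_mul_pi (repr x)) (fp_mul_pi (_ ++ _)) catA.
Qed.

Lemma fp_mul1 : left_id fp_one fp_mul.
Proof. by move=> x; rewrite -[x]reprK (fp_mul_pi [::]). Qed.

Lemma fp_mulr1 : right_id fp_one fp_mul.
Proof. by move=> x; rewrite -[x]reprK (fp_mul_pi _ [::]) cats0. Qed.

Lemma fp_mulV : left_inverse fp_one fp_inv fp_mul.
Proof.
move=> x; rewrite -[x]reprK fp_inv_pi fp_mul_pi.
by apply/fp_piP; exact: fp_wordV.
Qed.

Lemma inv_wordK : involutive inv_word.
Proof.
move=> u; rewrite /inv_word map_rev revK -map_comp map_id_in // => x _.
by case: x => x /=; rewrite invgK.
Qed.

Lemma fp_mulrV : right_inverse fp_one fp_inv fp_mul.
Proof.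
move=> x; rewrite -[x]reprK -[repr x]inv_wordK; set u := inv_word (repr x).
rewrite fp_inv_pi inv_wordK fp_mul_pi.
by apply/fp_piP; exact: fp_wordV.
Qed.

End FreeProd.

HB.instance Definition _ (G H : groupType) :=
  isGroup.Build (free_prod G H) (@fp_mulA G H) (@fp_mul1 G H) (@fp_mulr1 G H)
    (@fp_mulV G H) (@fp_mulrV G H).

Definition fp_inl (G H : groupType) (x : G) : free_prod G H :=
  \pi_(free_prod G H)%qT [:: inl x].
Definition fp_inr (G H : groupType) (y : H) : free_prod G H :=
  \pi_(free_prod G H)%qT [:: inr y].

Lemma fp_inlM (G H : groupType) (x y : G) :
  fp_inl H (x * y)%g = (fp_inl H x * fp_inl H y)%g.
Proof. by rewrite [RHS]fp_mul_pi; apply/fp_piP/fp_sym/fp_mull. Qed.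

Lemma fp_inrM (G H : groupType) (x y : H) :
  fp_inr G (x * y)%g = (fp_inr G x * fp_inr G y)%g.
Proof. by rewrite [RHS]fp_mul_pi; apply/fp_piP/fp_sym/fp_mulr. Qed.

Lemma fp_inl1 (G H : groupType) : fp_inl H (1 : G)%g = 1%g.
Proof. by apply/fp_piP/fp_onel. Qed.

Lemma fp_inr1 (G H : groupType) : fp_inr G (1 : H)%g = 1%g.
Proof. by apply/fp_piP/fp_oner. Qed.

(** The minimum of a set of naturals ([0] if the set is empty). *)
Definition least (P : set nat) : nat :=
  xget 0%N [set n | P n /\ forall i, P i -> (n <= i)%N].

(** The cardinality of a finite set ([0] if the set is infinite). *)
Definition card_set (T : choiceType) (A : set T) : nat := #|` fset_set A |.

Section GroupNotions.
Local Open Scope group_scope.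
Variable G : groupType.
Implicit Types (S : seq G) (C : set G) (g : G).

Definition word_length S g : nat :=
  least [set n | exists w : seq G,
    [/\ size w = n, {subset w <= S} & \prod_(x <- w) x = g]].

Definition conj_class g : set G := [set g ^ h | h in [set: G]].

Definition class_length S C : nat := least [set word_length S h | h in C].

Definition involution g : Prop := g <> 1 /\ g ^+ 2 = 1.

(* Natural exponents suffice: [h ^- n] is [(h^-1) ^+ n]. *)
Definition primitive g : Prop :=
  forall (h : G) (n : nat), (1 < n)%N -> h <> g -> h ^+ n <> g.

Definition expgz g (z : int) : G :=
  match z with Posz n => g ^+ n | Negz n => g ^- n.+1 end.

End GroupNotions.

(** [Z_2 * Z_k] with [k = 2 * m], for [2 <= m]; the cyclic factors are the
    additive groups of ['Z_2] and ['Z_(2 * m)], generated by [1%R]. *)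
Definition hecke_group (m : nat) : Type := free_prod 'Z_2 'Z_(2 * m)%N.

HB.instance Definition _ (m : nat) := Group.on (hecke_group m).

Section Hecke.
Local Open Scope group_scope.
Variable m : nat.
Local Notation Gam := (hecke_group m).

Definition gen_a : Gam := fp_inl _ (1%R : 'Z_2).
Definition gen_b : Gam := fp_inr _ (1%R : 'Z_(2 * m)%N).

Definition gens : seq Gam := [:: gen_a; gen_b; gen_b^-1].

(** Reciprocal geodesics of the Hecke surface [X_k] based at its cone point of
    order [k]. They enter only through the isomorphism of [Z_2 * Z_k] with the
    Hecke group, as conjugacy classes. *)
Definition reciprocal_geodesic : set (set Gam) :=
  [set C | exists u v : Gam,
    [/\ involution u /\ conj_class (gen_b ^+ m) u,
        involution v /\ conj_class (gen_b ^+ m) v,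
        u <> v & C = conj_class (u * v)]].

Definition primitive_reciprocal_geodesic : set (set Gam) :=
  [set C | reciprocal_geodesic C /\ forall g, C g -> primitive g].

Definition geodesics_of_length (A : set (set Gam)) (n : nat) : set (set Gam) :=
  [set C | A C /\ class_length gens C = n].

Definition admissible_exp (l : int) : Prop :=
  [/\ l <> 0%R, (- m%:Z + 1 <= l)%R & (l <= m%:Z)%R].

(** The elements [a b^x_0 a b^x_1 ... a b^x_(n-1) a]. *)
Definition aa_word (h : Gam) : Prop :=
  exists2 s : seq int, (forall l, l \in s -> admissible_exp l) &
    h = (\prod_(l <- s) (gen_a * expgz gen_b l)) * gen_a.

(* The commutator is [x h x^-1 h^-1], not the library's [x^-1 h^-1 x h]. *)
Definition commutators_of_length (n : nat) : set Gam :=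
  [set g | (exists2 h, aa_word h & g = gen_b ^+ m * h * gen_b ^- m * h^-1)
           /\ word_length gens g = n].

End Hecke.

Arguments reciprocal_geodesic : clear implicits.
Arguments primitive_reciprocal_geodesic : clear implicits.
Arguments commutators_of_length : clear implicits.

Definition hecke_poly (m : nat) (R : comNzRingType) : {poly R} :=
  'X^(m.+1) - \sum_(1 <= i < m) 2%:R *: 'X^i - 1.

(** [e] is the coefficient of [beta ^+ t] in the expansion of the number of
    commutators of length [2 * t], [3 <= t], on the powers of the [m.+1] distinct
    complex roots of [hecke_poly m]. These roots are nonzero, so that the
    coefficients are unique by the Vandermonde determinant. *)
Definition leading_coefficient (R : realType) (m : nat) (beta e : R) : Prop :=
  exists (lam : 'I_m.+1 -> R[i]) (c : 'I_m.+1 -> R[i]),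
    [/\ injective lam, forall i, root (hecke_poly m R[i]) (lam i),
        lam ord0 = (beta%:C)%C, c ord0 = (e%:C)%C &
        forall t : nat, (3 <= t)%N ->
          (card_set (commutators_of_length m (2 * t)%N))%:R =
          \sum_(i < m.+1) c i * lam i ^+ t].

(** The default values of [least] and [card_set] are never reached above: every
    element is a product of the generators, and the counted sets are finite. *)

Lemma leastP (P : set nat) : P !=set0 -> P (least P).
Proof.
move=> [n Pn]; rewrite /least; case: xgetP => [y _ [] //|/(_ _) noP].
have exP : exists n, `[< P n >] by exists n; apply/asboolP.
have [i /asboolP Pi mini] := ex_minnP exP.
by case: (noP i); split=> // j Pj; apply: mini; apply/asboolP.
Qed.

Section Finiteness.
Local Open Scope group_scope.
Variable m : nat.
Local Notation Gam := (hecke_group m).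

Lemma hecke_generated (g : Gam) :
  exists2 w : seq Gam, {subset w <= gens m} & \prod_(x <- w) x = g.
Proof.
have gen_nseq x n : x \in gens m ->
    {subset nseq n x <= gens m} by move=> xS y /nseqP[->].
rewrite -[g]reprK; elim: (repr g) => [|x u [w wS wE]].
  by exists [::] => //; rewrite big_nil.
have consE : \pi_(free_prod 'Z_2 'Z_(2 * m)%N)%qT (x :: u) =
    (\pi_(free_prod 'Z_2 'Z_(2 * m)%N)%qT [:: x] : Gam) * \prod_(y <- w) y.
  by rewrite wE [RHS]fp_mul_pi.
rewrite consE {consE wE}.
suff [v vS <-] : exists2 v : seq Gam, {subset v <= gens m} &
    \prod_(y <- v) y = (\pi_(free_prod 'Z_2 'Z_(2 * m)%N)%qT [:: x] : Gam).
  exists (v ++ w); last by rewrite big_cat.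
  by move=> y; rewrite mem_cat => /orP[/vS|/wS].
case: x => x.
- exists (nseq x (gen_a m)); first by apply: gen_nseq; rewrite !inE eqxx.
  rewrite -[in RHS](natr_Zp x) -[RHS]/(fp_inl _ (x%:R%R : 'Z_2)).
  elim: (nat_of_ord x) => [|n IHn] /=; first by rewrite big_nil -fp_inl1.
  by rewrite big_cons IHn -fp_inlM mulrS.
- exists (nseq x (gen_b m)).
    by apply: gen_nseq; rewrite !inE eqxx orbT.
  rewrite -[in RHS](natr_Zp x) -[RHS]/(fp_inr _ (x%:R%R : 'Z_(2 * m)%N)).
  elim: (nat_of_ord x) => [|n IHn] /=; first by rewrite big_nil -fp_inr1.
  by rewrite big_cons IHn -fp_inrM mulrS.
Qed.

Lemma finite_sphere (n : nat) :
  finite_set [set g : Gam | word_length (gens m) g = n].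
Proof.
pose f (t : n.-tuple 'I_3) : Gam := \prod_(i <- t) nth 1 (gens m) i.
apply: (@sub_finite_set _ _ (f @` [set: n.-tuple 'I_3])); last first.
  exact/finite_image/finite_finset.
move=> g /= gn.
have [w [szw wS wg]] : [set n | exists w : seq Gam,
    [/\ size w = n, {subset w <= gens m} & \prod_(x <- w) x = g]] n.
  rewrite -gn; apply: leastP; have [w wS wg] := hecke_generated g.
  by exists (size w), w.
have szt : size [seq inord (index x (gens m)) : 'I_3 | x <- w] == n.
  by rewrite size_map szw.
exists (Tuple szt) => //; rewrite /f /= big_map -wg.
apply: eq_big_seq => x /wS xS; rewrite inordK ?nth_index //.
by move: xS; rewrite -index_mem.
Qed.

Lemma finite_commutators (n : nat) : finite_set (commutators_of_length m n).
Proof. by apply: sub_finite_set (finite_sphere n) => g []. Qed.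

Lemma finite_geodesics (n : nat) :
  finite_set (geodesics_of_length (reciprocal_geodesic m) n).
Proof.
apply: sub_finite_set (finite_image (@conj_class Gam) (finite_sphere n)).
move=> _ [[u [v [_ _ _ ->]]] Cn].
have [h Ch hn] : [set word_length (gens m) h | h in conj_class (u * v)] n.
  rewrite -Cn; apply: leastP; exists (word_length (gens m) (u * v)), (u * v) => //.
  by exists 1; rewrite ?conjg1.
exists h => //; case: Ch => y _ <-; apply/seteqP; split=> [_ [z _ <-]|_ [z _ <-]].
- by exists (y * z) => //; rewrite conjgM.
- by exists (y^-1 * z) => //; rewrite conjgM conjgK.
Qed.

Lemma finite_primitive_geodesics (n : nat) :
  finite_set (geodesics_of_length (primitive_reciprocal_geodesic m) n).
Proof. by apply: sub_finite_set (finite_geodesics n) => C [[]]. Qed.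

End Finiteness.

(* Main.v *)
(** Up to conjugation, a product of two distinct conjugates of [b^m] is a
    commutator [[b^m, h]] with [h = a b^x_0 a ... b^x_(n-1) a], which is cyclically
    reduced with cyclic word [(m, x_0, ..., x_(n-1), m, -x_(n-1), ..., -x_0)]. Cyclically
    reduced elements are conjugate exactly when their cyclic words are rotations
    of each other, and this word is odd about each of its two entries [m], so two
    such words that are rotations of each other by [r] have the period [2r].
    Hence a word without proper period is conjugate to exactly one other word of
    this form, the one of [h^-1], and its class is primitive. A word with a proper
    period is determined, up to polynomially many choices, by a quarter of its
    letters, so these words are [O(t^3 beta^(t/2))] among [e beta^t]. Halving the
    number of commutators gives both counts. The commutators satisfy a linear recurrence,
    solved by [sum_i lam_i^(t-1) / p'(lam_i)] over the roots of its characteristic polynomial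
    [p]; thus [e = 1 / (beta p'(beta))], and [beta] strictly dominates the other
    roots. *)

Require Import Defs.
From mathcomp Require Import all_boot all_order all_algebra all_fingroup.
From mathcomp Require Import generic_quotient finmap complex zify ring lra.
From mathcomp Require Import all_classical all_reals all_analysis.
Import Order.TTheory GRing.Theory Num.Theory.
Import numFieldNormedType.Exports.
Set Implicit Arguments.
Unset Strict Implicit.
Unset Printing Implicit Defensive.
Local Open Scope ring_scope.

(** * Normal forms and conjugacy in [Z_2 * Z_2m] *)

Section NormalForms.
Variable m : nat.
Local Notation Z := 'Z_(2 * m).
Local Notation Gam := (hecke_group m).

Definition bz (z : Z) : Gam := fp_inr _ z.
Local Notation A := (gen_a m).

Lemma bzD x y : bz (x + y) = (bz x * bz y)%g.
Proof. exact: fp_inrM. Qed.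

Lemma bz0 : bz 0 = 1%g.
Proof. exact: fp_inr1. Qed.

Lemma bzN x : bz (- x) = (bz x)^-1%g.
Proof. by apply: (mulIg (bz x)); rewrite -bzD addNr bz0 mulVg. Qed.

Lemma bzMn x n : (bz x ^+ n)%g = bz (x *+ n).
Proof.
elim: n => [|n IHn]; first by rewrite bz0 expg0.
by rewrite expgS IHn -bzD mulrS.
Qed.

Lemma gen_bX n : (gen_b m ^+ n)%g = bz n%:R.
Proof. exact: bzMn. Qed.

Lemma expgz_bz l : expgz (gen_b m) l = bz l%:~R.
Proof.
case: l => n /=; first by rewrite gen_bX.
by rewrite NegzE gen_bX rmorphN /= bzN.
Qed.

Lemma gen_aK : (A * A)%g = 1%g.
Proof.
by rewrite -[RHS](@fp_inl1 'Z_2 Z) -[LHS]fp_inlM; congr (fp_inl _ _); exact/val_inj.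
Qed.

Lemma gen_aV : (A^-1)%g = A.
Proof. by apply: (mulIg A); rewrite mulVg gen_aK. Qed.

(* The list [l_0 :: s] stands for [b^l_0 a b^s_1 a ... a b^s_n]; it is a normal
   form when no exponent other than the first and the last vanishes. *)
Definition act_b (z : Z) (l : seq Z) : seq Z :=
  if l is x :: s then (z + x) :: s else [::].

(** A leading 0 cancels only when an exponent follows it: [[:: 0]] is the identity, which [a] sends
    to [[:: 0; 0]]. *)
Definition act_a (l : seq Z) : seq Z :=
  if l is x :: s then if (x == 0) && (s != [::]) then s else 0 :: l else [::].

Fixpoint inner (s : seq Z) : bool :=
  if s is y :: s' then ((s' == [::]) || (y != 0)) && inner s' else true.

Definition ok (l : seq Z) : bool := if l is _ :: s then inner s else false.

Definition step (x : 'Z_2 + Z) (l : seq Z) : seq Z :=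
  match x with inl e => if e == 0 then l else act_a l | inr z => act_b z l end.

Definition act_word (u : seq ('Z_2 + Z)) (l : seq Z) : seq Z := foldr step l u.

Lemma ok_act_a l : ok l -> ok (act_a l).
Proof.
case: l => //= x s inner_s; case: ifP => [/andP[_ s0]|].
  by case: s s0 inner_s => //= y s _ /andP[].
by move=> /negbT; rewrite negb_and negbK orbC /= => ->.
Qed.

Lemma ok_step x l : ok l -> ok (step x l).
Proof.
case: x => [e|z] /=; last by case: l.
by case: ifP => // _; exact: ok_act_a.
Qed.

Lemma ok_act_word u l : ok l -> ok (act_word u l).
Proof. by move=> okl; elim: u => //= x u IHu; exact: ok_step. Qed.

Lemma act_aK l : ok l -> act_a (act_a l) = l.
Proof.
case: l => // x s /= inner_s; case: (ifP (_ && _)) => [/andP[/eqP-> s0]|xs].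
  case: s s0 inner_s => //= y s _ /andP[+ _].
  by case: (y == 0); case: (s == [::]).
by [].
Qed.

(** Van der Waerden's argument: the letters act on normal forms compatibly with the relations of the
    free product. Only the relation [a a = 1] uses normality. *)
Lemma act_word_equiv u v l : fp_equiv u v -> ok l -> act_word u l = act_word v l.
Proof.
move=> uv; elim: uv l => {u v} //=.
- by move=> u v _ IH l okl; rewrite IH.
- by move=> u v w _ IHu _ IHv l okl; rewrite IHu // IHv.
- move=> u u' v v' _ IHu _ IHv l okl.
  by rewrite /act_word !foldr_cat -!/(act_word _ _) IHv // IHu // ok_act_word.
- move=> x y l okl.
  have act2 : forall z : 'Z_2, z = 0 \/ z = 1.
    by case=> [[|[|]]] // lt2; [left|right]; apply/val_inj.
  by case: (act2 x) => ->; case: (act2 y) => -> //=; rewrite act_aK.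
- by move=> x y [|z l] //= _; rewrite -addrA.
- by move=> [|z l] //= _; rewrite add0r.
Qed.

(** * The group action and uniqueness of normal forms *)

Definition act (g : Gam) : seq Z -> seq Z := act_word (repr g).

Lemma ok_act g l : ok l -> ok (act g l).
Proof. exact: ok_act_word. Qed.

Lemma act_pi u l : ok l -> act (\pi_(free_prod 'Z_2 Z)%qT u : Gam) l = act_word u l.
Proof. by apply: act_word_equiv; exact: fp_reprP. Qed.

Lemma actM g h l : ok l -> act (g * h)%g l = act g (act h l).
Proof.
move=> okl; rewrite [LHS]act_pi // /act /act_word foldr_cat //.
Qed.

Lemma act1 l : ok l -> act 1%g l = l.
Proof. by move=> okl; rewrite [LHS]act_pi. Qed.

Lemma act_bz z l : ok l -> act (bz z) l = act_b z l.
Proof. exact: act_pi. Qed.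

Lemma act_gen_a l : ok l -> act A l = act_a l.
Proof. exact: act_pi. Qed.

Definition nf (g : Gam) : seq Z := act g [:: 0].

Lemma ok_nf g : ok (nf g).
Proof. exact: ok_act. Qed.

Definition ev_tail (s : seq Z) : Gam := (\prod_(y <- s) (A * bz y))%g.

Definition ev (l : seq Z) : Gam :=
  if l is x :: s then (bz x * ev_tail s)%g else 1%g.

Lemma ev_tail_cons y s : ev_tail (y :: s) = (A * bz y * ev_tail s)%g.
Proof. by rewrite /ev_tail big_cons. Qed.

Lemma ev_act_b z l : ok l -> ev (act_b z l) = (bz z * ev l)%g.
Proof. by case: l => //= x s _; rewrite bzD mulgA. Qed.

Lemma ev_act_a l : ok l -> ev (act_a l) = (A * ev l)%g.
Proof.
case: l => //= x s _; case: ifP => [/andP[/eqP-> s0]|_] /=.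
  case: s s0 => //= y s _; rewrite ev_tail_cons bz0 mul1g !mulgA gen_aK mul1g //.
by rewrite bz0 mul1g ev_tail_cons mulgA.
Qed.

Lemma ev_act g l : ok l -> ev (act g l) = (g * ev l)%g.
Proof.
move=> okl; rewrite -[in RHS](reprK g) /act; elim: (repr g) => [|x u IHu] /=.
  by rewrite [X in (X * _)%g](_ : _ = 1%g) // mul1g.
have oku := ok_act_word u okl.
have -> : \pi_(free_prod 'Z_2 Z)%qT (x :: u) =
    ((\pi_(free_prod 'Z_2 Z)%qT [:: x] : Gam) * \pi_(free_prod 'Z_2 Z)%qT u)%g :> Gam.
  by rewrite [RHS]fp_mul_pi.
rewrite -mulgA -IHu; case: x => [e|z] /=; last by rewrite ev_act_b.
have [->|e0] := eqVneq e 0.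
  by rewrite -[\pi_(_)%qT _]/(fp_inl _ (1%g : 'Z_2)) fp_inl1 mul1g.
rewrite ev_act_a //; congr (_ * _)%g; rewrite /gen_a /fp_inl; congr (\pi_(_)%qT [:: inl _]).
by case: e e0 => [[|[|]]] // lt2 _; apply/val_inj.
Qed.

Lemma nfK g : ev (nf g) = g.
Proof. by rewrite /nf ev_act //= bz0 /ev_tail big_nil !mulg1. Qed.

Lemma act_ev_tail s : inner s -> act (ev_tail s) [:: 0] = 0 :: s.
Proof.
elim: s => [|y s IHs] /=; first by rewrite /ev_tail big_nil act1.
move=> /andP[ys inner_s]; rewrite ev_tail_cons !actM ?ok_act // IHs //.
rewrite act_bz // act_gen_a //= addr0.
by case: (y == 0) ys; case: (s == [::]).
Qed.

(** With [nfK] this makes normal lists unique representatives of the group elements. *)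
Lemma evK l : ok l -> nf (ev l) = l.
Proof.
case: l => //= x s inner_s; rewrite /nf actM // act_ev_tail // act_bz //=.
by rewrite addr0.
Qed.

Lemma inner_rcons s z : inner (rcons s z) = (0 \notin s).
Proof.
by elim: s => //= y s ->; rewrite inE negb_or [0 == _]eq_sym; case: s.
Qed.

(** A letter inserts, deletes or changes a single leading entry, so [n] letters touch at most [n]
    entries of [l]. The strict bound keeps the untouched part [drop c l] nonempty. *)
Lemma act_word_local u l : (size u < size l)%N ->
  exists p c, [/\ (size p <= size u)%N, (c <= size u)%N &
    act_word u l = p ++ drop c l].
Proof.
move=> szl; elim: u szl => [|x u IHu] /= szl; first by exists [::], 0%N; rewrite drop0.
have [p [c [szp cu ->]]] := IHu (ltnW szl).
have cl : (c < size l)%N by rewrite (leq_ltn_trans cu) // ltnW.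
case: x => [e|z].
- rewrite /step; case: ifP => [_|_]; first by exists p, c; rewrite !leqW.
  case: p szp => [|x p] szp.
  + rewrite cat0s (drop_nth 0 cl) /=; case: ifP => _.
      by exists [::], c.+1.
    by exists [:: 0], c; split; [|exact: leqW|rewrite (drop_nth 0 cl)].
  + rewrite /=; case: ifP => _.
      by exists p, c; rewrite !leqW // ltnW.
    by exists [:: 0, x & p], c; split => //; exact: leqW.
- case: p szp => [|x p] szp.
  + by exists [:: z + nth 0 l c], c.+1; rewrite /= (drop_nth 0 cl).
  + by exists (z + x :: p), c; rewrite /= !leqW.
Qed.

(** * Inverses, cyclic words and locality of multiplication *)

Definition inv_seq (s : seq Z) : seq Z := rev (map -%R s).

Lemma inv_seqK : involutive inv_seq.
Proof. by move=> s; rewrite /inv_seq map_rev revK mapK //; exact: opprK. Qed.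

Lemma size_inv_seq s : size (inv_seq s) = size s.
Proof. by rewrite size_rev size_map. Qed.

Lemma inv_seq_cat s t : inv_seq (s ++ t) = inv_seq t ++ inv_seq s.
Proof. by rewrite /inv_seq map_cat rev_cat. Qed.

Lemma mem0_inv_seq s : (0 \in inv_seq s) = (0 \in s).
Proof. by rewrite /inv_seq mem_rev -{1}oppr0 mem_map //; exact: oppr_inj. Qed.

(** Each exponent carries its own letter [a], so that concatenation is multiplication and rotation
    is conjugation, as suits cyclic words. *)
Definition Wd (s : seq Z) : Gam := (\prod_(y <- s) (bz y * A))%g.

Lemma Wd_cons y s : Wd (y :: s) = (bz y * A * Wd s)%g.
Proof. by rewrite /Wd big_cons. Qed.

Lemma Wd_cat s t : Wd (s ++ t) = (Wd s * Wd t)%g.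
Proof. by rewrite /Wd big_cat. Qed.

Lemma ev_rcons s z : ev (rcons s z) = (Wd s * bz z)%g.
Proof.
elim: s => [|y s /= IHs]; first by rewrite /= /Wd /ev_tail !big_nil mulg1 mul1g.
rewrite Wd_cons -!mulgA -IHs; congr (_ * _)%g.
by case: s {IHs} => [|x s] /=; rewrite ev_tail_cons mulgA.
Qed.

Lemma nf_Wd s : 0 \notin s -> nf (Wd s) = rcons s 0.
Proof.
move=> s0; rewrite -[Wd s]mulg1 -bz0 -ev_rcons evK //.
by case: s s0 => //= y s; rewrite inE negb_or inner_rcons => /andP[].
Qed.

Lemma WdV s : ((Wd s)^-1)%g = ev_tail (inv_seq s).
Proof.
elim: s => [|y s IHs]; first by rewrite /Wd /ev_tail !big_nil invg1.
rewrite Wd_cons invgM IHs invgM gen_aV -bzN /inv_seq /= rev_cons /ev_tail.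
by rewrite -cats1 big_cat /= big_seq1.
Qed.

Lemma evV l : ok l -> ((ev l)^-1)%g = ev (inv_seq l).
Proof.
case/lastP: l => // s z _; rewrite ev_rcons invgM WdV -bzN.
by rewrite /inv_seq map_rcons rev_rcons.
Qed.

Lemma ok_inv l : ok l -> ok (inv_seq l).
Proof.
case: l => // x s; case/lastP: s => // s z.
rewrite /ok inner_rcons => s0.
rewrite /inv_seq /= map_rcons rev_cons rev_rcons /= inner_rcons.
by rewrite -/(inv_seq s) mem0_inv_seq.
Qed.

Lemma nfV g : nf g^-1%g = inv_seq (nf g).
Proof. by rewrite -{1}(nfK g) evV ?ok_nf // evK // ok_inv // ok_nf. Qed.

Lemma nfM g h : nf (g * h)%g = act g (nf h).
Proof. by rewrite /nf actM. Qed.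

Lemma mul_local_l g : exists K, forall l, (K < size l)%N -> exists p c,
  [/\ (size p <= K)%N, (c <= K)%N & act g l = p ++ drop c l].
Proof. by exists (size (repr g)) => l; exact: act_word_local. Qed.

(** Inversion reverses and negates normal forms, which turns the prefix statement of [mul_local_l]
    for [g^-1] into one about suffixes. *)
Lemma mul_local_r g : exists K, forall h, (K < size (nf h))%N -> exists q c,
  [/\ (size q <= K)%N, (c <= K)%N &
      nf (h * g)%g = take (size (nf h) - c) (nf h) ++ q].
Proof.
have [K HK] := mul_local_l g^-1%g; exists K => h Kh.
have := HK (nf h^-1%g); rewrite nfV size_inv_seq => /(_ Kh) [p [c [szp cK E]]].
exists (inv_seq p), c; rewrite size_inv_seq; split => //.
apply: (can_inj inv_seqK); rewrite -nfV invgM nfM nfV E inv_seq_cat inv_seqK.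
congr (_ ++ _); rewrite /inv_seq map_take rev_take size_map subKn //.
exact: leq_trans cK (ltnW Kh).
Qed.


(** * Rotations, powers and conjugacy of cyclic words *)

Lemma nth_rot_mod (T : Type) (x0 : T) (s : seq T) r j : (r <= size s)%N ->
  (j < size s)%N -> nth x0 (rot r s) j = nth x0 s ((j + r) %% size s).
Proof.
move=> rs js; rewrite /rot nth_cat size_drop nth_drop addnC; case: ltnP => jr.
  by rewrite modn_small //; lia.
rewrite nth_take; last by lia.
congr (nth x0 s _); have -> : (j + r = j - (size s - r) + size s)%N by lia.
by rewrite modnDr modn_small //; lia.
Qed.

Lemma nth_flatten_nseq (T : Type) (x0 : T) (s : seq T) n i : (i < n * size s)%N ->
  nth x0 (flatten (nseq n s)) i = nth x0 s (i %% size s).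
Proof.
elim: n i => // n IHn i; rewrite mulSn => /= ilt; rewrite nth_cat; case: ltnP => si.
  by rewrite modn_small.
rewrite IHn; last by lia.
by congr (nth x0 s _); rewrite -[in RHS](subnK si) modnDr.
Qed.

Lemma size_flatten_nseq (T : Type) (s : seq T) n :
  size (flatten (nseq n s)) = (n * size s)%N.
Proof. by elim: n => //= n IHn; rewrite size_cat IHn mulSn. Qed.

Lemma WdX s n : (Wd s ^+ n)%g = Wd (flatten (nseq n s)).
Proof.
elim: n => [|n IHn] /=; first by rewrite /Wd big_nil expg0.
by rewrite expgS IHn Wd_cat.
Qed.

Lemma mem0_flatten_nseq (s : seq Z) n : 0 \notin s -> 0 \notin flatten (nseq n s).
Proof.
by move=> s0; elim: n => //= n IHn; rewrite mem_cat negb_or s0.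
Qed.

(* For large [n], both sides of [h * Wd x ^+ n = Wd y ^+ n * h] coincide with a periodic word away from a
   bounded number of entries at the ends. *)
Lemma Wd_conj_rot (x y : seq Z) (h : Gam) : 0 \notin x -> 0 \notin y ->
  (0 < size x)%N -> (0 < size y)%N -> (h * Wd x)%g = (Wd y * h)%g ->
  exists2 r, (r < size x)%N & y = rot r x.
Proof.
move=> x0 y0 sx sy hxy.
have hX n : (h * Wd x ^+ n)%g = (Wd y ^+ n * h)%g.
  elim: n => [|n IHn]; first by rewrite !expg0 mul1g mulg1.
  by rewrite expgSr mulgA IHn -mulgA hxy mulgA -expgSr.
have [K1 HK1] := mul_local_l h; have [K2 HK2] := mul_local_r h.
(* [K] bounds the number of entries disturbed at either end. With [n > 3 * K], unequal sizes would
   make the lengths of the powers differ by more than [K], and a full period starting at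
   [K * size x] lies in the undisturbed middle. *)
pose K := (K1 + K2)%N; pose n := (3 * K + 2)%N.
have nfX (z : seq Z) : 0 \notin z -> nf (Wd z ^+ n)%g = rcons (flatten (nseq n z)) 0.
  by move=> z0; rewrite WdX nf_Wd // mem0_flatten_nseq.
have Kx : (n <= n * size x)%N by rewrite leq_pmulr.
have Ky : (n <= n * size y)%N by rewrite leq_pmulr.
have := HK1 (nf (Wd x ^+ n)%g); rewrite nfX // size_rcons size_flatten_nseq.
have Kn : (K < n)%N by rewrite /n; lia.
case; first by rewrite /K in Kn; lia.
move=> p [c [pK cK Ex]].
have := HK2 (Wd y ^+ n)%g; rewrite nfX // size_rcons size_flatten_nseq.
case; first by rewrite /K in Kn; lia.
move=> q [d [qK dK Ey]].
have E : p ++ drop c (rcons (flatten (nseq n x)) 0) =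
    take ((n * size y).+1 - d) (rcons (flatten (nseq n y)) 0) ++ q.
  by rewrite -Ex -Ey -hX nfM nfX.
have sxy : size x = size y.
  have := congr1 size E; rewrite !size_cat size_drop size_takel !size_rcons ?leq_subr //; last first.
    by rewrite size_flatten_nseq leq_subr.
  rewrite !size_flatten_nseq => Es.
  have dlt : (d <= (n * size y).+1)%N by rewrite /K in Kn; lia.
  have {}Es : (size p + (n * size x) + d = n * size y + size q + c)%N.
    by rewrite /K in Kn; lia.
  case: (ltngtP (size x) (size y)) => // lt.
  - have : (n * (size x).+1 <= n * size y)%N by rewrite leq_mul2l lt orbT.
    by rewrite mulnS /K in Kn *; lia.
  - have : (n * (size y).+1 <= n * size x)%N by rewrite leq_mul2l lt orbT.
    by rewrite mulnS /K in Kn *; lia.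
(* Position [K * size x + j] has phase [j] in the power of [y]; in the power of [x] it is entry
   [c + (K * size x + j - size p)]. *)
exists ((c + (K * size x - size p)) %% size x)%N; first by rewrite ltn_mod.
apply: (@eq_from_nth _ 0); first by rewrite size_rot.
move=> j; rewrite -sxy => jx; rewrite nth_rot_mod //; last by rewrite ltnW // ltn_mod.
have pK' : (size p <= K)%N by rewrite (leq_trans pK) ?leq_addr.
have cK' : (c <= K)%N by rewrite (leq_trans cK) ?leq_addr.
have dK' : (d <= K)%N by rewrite (leq_trans dK) ?leq_addl.
have cdK : (c + d <= K)%N by rewrite leq_add.
have KM : (K <= K * size x)%N by rewrite leq_pmulr.
have nM : (n * size x = 3 * (K * size x) + 2 * size x)%N by rewrite /n; lia.
have pj : (size p <= K * size x + j)%N by lia.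
have cj : (c + (K * size x + j - size p) < n * size x)%N by lia.
have dj : (K * size x + j < (n * size x).+1 - d)%N by lia.
have nj : (K * size x + j < n * size x)%N by lia.
have := congr1 (fun s => nth 0 s (K * size x + j)%N) E.
rewrite nth_cat ltnNge pj /= nth_drop nth_rcons size_flatten_nseq cj.
rewrite nth_flatten_nseq // nth_cat size_takel; last first.
  by rewrite size_rcons size_flatten_nseq leq_subr.
rewrite -sxy dj nth_take // nth_rcons size_flatten_nseq -sxy nj.
rewrite nth_flatten_nseq -sxy // modnMDl (modn_small jx) => <-.
congr (nth _ _ _); rewrite modnDmr; congr (_ %% _)%N.
by move: (K * size x)%N KM pj => a; lia.
Qed.

Lemma conjg_mulC (u v : Gam) : ((u * v) ^ u)%g = (v * u)%g.
Proof. by rewrite conjgE -mulgA mulKg. Qed.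

Lemma bz_expg z : (0 < m)%N -> (bz z ^+ (2 * m))%g = 1%g.
Proof.
move=> m0; rewrite bzMn -mulr_natr pchar_Zp ?mulr0 ?bz0 //; lia.
Qed.

(** Rotating a vanishing exponent to the front exposes a letter [a] that cancels cyclically and
    merges the two neighbouring exponents. The word shortens until no exponent vanishes, or until
    [1], [a] or a power of [b] remains, all of finite order. *)
Lemma cyclic_reduction (g : Gam) : (0 < m)%N ->
  (exists2 n, (0 < n)%N & (g ^+ n)%g = 1%g) \/
  exists h (v : seq Z), [/\ 0 \notin v, (0 < size v)%N & (g ^ h)%g = Wd v].
Proof.
move=> m0; set P := fun g : Gam => (exists2 n, (0 < n)%N & (g ^+ n)%g = 1%g) \/
  exists h (v : seq Z), [/\ 0 \notin v, (0 < size v)%N & (g ^ h)%g = Wd v].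
have PC u v : P (v * u)%g -> P (u * v)%g.
  rewrite -conjg_mulC => -[[n n0 E]|[h [w [w0 sw E]]]].
    by left; exists n => //; apply: (@conjg_inj _ u); rewrite conjXg E conj1g.
  by right; exists (u * h)%g, w; rewrite conjgM.
have Pb z : P (bz z) by left; exists (2 * m)%N; [lia|exact: bz_expg].
have PW s : P (Wd s).
  have [n] := ubnP (size s); elim: n s => // n IHn s.
  have [/splitPr[s1 s2]|s0] := boolP (0 \in s); last first.
    case: s s0 => [|x s] s0 _; first by left; exists 1%N; rewrite // /Wd big_nil expg1.
    by right; exists 1%g, (x :: s); rewrite conjg1.
  rewrite Wd_cat => sn; apply: (PC); rewrite -Wd_cat /= Wd_cons bz0 mul1g.
  have : (size (s2 ++ s1) < n)%N by move: sn; rewrite !size_cat /=; lia.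
  case: (s2 ++ s1) => [|z t] st.
    by left; exists 2%N; rewrite // /Wd big_nil mulg1 expgS expg1 gen_aK.
  apply: (PC); case/lastP: t st => [|t w] st.
    by rewrite Wd_cons /Wd big_nil mulg1 -mulgA gen_aK mulg1; exact: Pb.
  rewrite -cats1 -cat_cons Wd_cat [Wd [:: w]]Wd_cons {2}/Wd big_nil mulg1.
  rewrite -mulgA -[(_ * A * A)%g]mulgA gen_aK mulg1; apply: (PC).
  rewrite Wd_cons !mulgA -bzD -Wd_cons; apply: IHn.
  by move: st; rewrite /= size_rcons; lia.
suff : P (ev (nf g)) by rewrite nfK.
have := ok_nf g; case/lastP: (nf g) => // s z _.
rewrite ev_rcons; apply: (PC); case: s => [|x s]; first by rewrite /Wd big_nil mulg1.
by rewrite Wd_cons !mulgA -bzD -Wd_cons.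
Qed.

End NormalForms.

(** * Word length and reciprocal classes *)

Lemma least_eq (P : set nat) n : P n -> (forall i, P i -> (n <= i)%N) -> least P = n.
Proof.
move=> Pn minn; apply/eqP; rewrite eqn_leq minn ?andbT; last by apply: leastP; exists n.
rewrite /least; case: xgetP => [y _ [_ /(_ _ Pn)] //|/(_ n)].
by case.
Qed.

Section Lengths.
Variable m : nat.
Hypothesis hm : (2 <= m)%N.
Local Notation Z := 'Z_(2 * m).
Local Notation Gam := (hecke_group m).
Local Notation A := (gen_a m).

Lemma ZE : (Zp_trunc (2 * m)).+2 = (2 * m)%N.
Proof. by rewrite Zp_cast //; lia. Qed.

Lemma ltnZ (z : Z) : (z < 2 * m)%N.
Proof. by rewrite -{2}ZE. Qed.

Lemma valZ_add (x y : Z) : (x + y)%R = ((x + y) %% (2 * m))%N :> nat.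
Proof. by rewrite -[X in (_ %% X)%N]ZE. Qed.

Lemma valZ_nat n : (n%:R : Z) = (n %% (2 * m))%N :> nat.
Proof. by rewrite val_Zp_nat //; lia. Qed.

Lemma valZ_opp (x : Z) : (- x)%R = ((2 * m - x) %% (2 * m))%N :> nat.
Proof.
have -> : (2 * m - x = (Zp_trunc (2 * m)).+2 - x)%N by congr (_ - _)%N; rewrite ZE.
by rewrite -[X in (_ %% X)%N]ZE.
Qed.

Definition absZ (z : Z) : nat := minn z (2 * m - z).

Lemma absZ0 : absZ 0 = 0%N.
Proof. by rewrite /absZ min0n. Qed.

Lemma valZ_eq0 (z : Z) : (z == 0) = (nat_of_ord z == 0%N).
Proof. by []. Qed.

Lemma absZ_le z : (absZ z <= m)%N.
Proof. by rewrite /absZ; have := ltnZ z; lia. Qed.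

Lemma absZN z : absZ (- z) = absZ z.
Proof.
have := ltnZ z; rewrite /absZ valZ_opp; case: (posnP z) => [->|z0] lt.
  by rewrite subn0 modnn; lia.
by rewrite modn_small; lia.
Qed.

Lemma absZ_add1 (z : Z) :
  (absZ (1 + z)%R <= (absZ z).+1)%N /\ (absZ z <= (absZ (1 + z)%R).+1)%N.
Proof.
have E1 : (1 : Z)%R = 1%N :> nat by rewrite -[1]/(1%:R) valZ_nat modn_small; lia.
have := ltnZ z; rewrite /absZ valZ_add E1 add1n => lt.
case: (ltngtP z.+1 (2 * m)) => zm; first by rewrite modn_small //; lia.
  by lia.
by rewrite zm modnn; lia.
Qed.

Lemma absZ_sub1 (z : Z) : (absZ (- 1 + z)%R <= (absZ z).+1)%N.
Proof. by have [_] := absZ_add1 (- 1 + z); rewrite addrA subrr add0r. Qed.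

(** The size term counts the letters [a], one between consecutive exponents; [absZ] is the cost of a
    power of [b]. *)
Definition wt (l : seq Z) : nat := ((size l).-1 + \sum_(y <- l) absZ y)%N.

Lemma wt_cons x s : wt (x :: s) = (absZ x + \sum_(y <- s) (absZ y).+1)%N.
Proof.
rewrite /wt big_cons /= addnCA; congr (_ + _)%N.
elim: s => [|y s IHs]; first by rewrite !big_nil.
by rewrite !big_cons -IHs /=; lia.
Qed.

Lemma wt_act_gen x l : x \in gens m -> ok l -> (wt (act x l) <= (wt l).+1)%N.
Proof.
rewrite !inE => /or3P[] /eqP-> okl.
- rewrite act_gen_a //; case: l okl => //= x0 s inner_s; case: ifP => [/andP[/eqP-> s0]|_].
    by case: s s0 inner_s => // y s _ _; rewrite !wt_cons big_cons; lia.
  by rewrite !wt_cons big_cons absZ0; lia.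
- rewrite act_bz //; case: l okl => //= x0 s _; rewrite !wt_cons.
  by rewrite -addSn leq_add2r; have [] := absZ_add1 x0.
- rewrite -bzN act_bz //; case: l okl => //= x0 s _; rewrite !wt_cons.
  by rewrite -addSn leq_add2r absZ_sub1.
Qed.

Lemma wt_act_word (w : seq Gam) l : {subset w <= gens m} -> ok l ->
  (wt (act (\prod_(x <- w) x)%g l) <= size w + wt l)%N.
Proof.
move=> ws okl; elim: w ws => [|x w IHw] ws; first by rewrite big_nil act1.
rewrite big_cons actM // (leq_trans (wt_act_gen _ _)) ?ok_act //.
  by apply: ws; rewrite mem_head.
by rewrite addSn ltnS IHw // => y yw; apply: ws; rewrite inE yw orbT.
Qed.

Definition spelled (g : Gam) (n : nat) : Prop := exists w : seq Gam,
  [/\ size w = n, {subset w <= gens m} & (\prod_(x <- w) x)%g = g].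

Lemma spelledM g h i j : spelled g i -> spelled h j -> spelled (g * h)%g (i + j)%N.
Proof.
move=> [u [su uS <-]] [v [sv vS <-]]; exists (u ++ v).
rewrite size_cat su sv big_cat; split => // x.
by rewrite mem_cat => /orP[/uS|/vS].
Qed.

Lemma spelled1 : spelled 1%g 0.
Proof. by exists [::]; rewrite big_nil. Qed.

Lemma spelled_gen x : x \in gens m -> spelled x 1.
Proof.
by move=> xS; exists [:: x]; rewrite big_seq1; split => // y; rewrite inE => /eqP->.
Qed.

Lemma spelledX g n : spelled g 1 -> spelled (g ^+ n)%g n.
Proof.
move=> g1; elim: n => [|n IHn]; first by rewrite expg0; exact: spelled1.
by rewrite expgS -add1n; exact: spelledM.
Qed.

Lemma spelled_bz z : spelled (bz z) (absZ z).
Proof.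
rewrite /absZ; case: leqP => _.
  rewrite -[z in bz z]natr_Zp -gen_bX; apply/spelledX/spelled_gen.
  by rewrite !inE eqxx orbT.
have -> : bz z = ((gen_b m)^-1 ^+ (2 * m - z))%g.
  rewrite expVgn gen_bX -bzN; congr bz.
  rewrite natrB ?(ltnW (ltnZ z)) // pchar_Zp; last by lia.
  by rewrite sub0r opprK natr_Zp.
by apply/spelledX/spelled_gen; rewrite !inE eqxx !orbT.
Qed.

Lemma spelled_ev_tail s : spelled (ev_tail s) (\sum_(y <- s) (absZ y).+1).
Proof.
elim: s => [|y s IHs]; first by rewrite /ev_tail !big_nil; exact: spelled1.
rewrite ev_tail_cons big_cons; apply: spelledM => //; rewrite -add1n.
by apply: spelledM; [apply: spelled_gen; rewrite !inE eqxx|exact: spelled_bz].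
Qed.

(** The normal form spells [g] with [wt (nf g)] letters, and a generator raises the weight by at
    most one, so no spelling is shorter. *)
Lemma word_length_nf g : word_length (gens m) g = wt (nf g).
Proof.
apply: least_eq => [|n [w [<- wS <-]]].
  suff : spelled (ev (nf g)) (wt (nf g)) by rewrite nfK.
  have := ok_nf g; case: (nf g) => // x s _.
  by rewrite wt_cons; apply: spelledM; [exact: spelled_bz|exact: spelled_ev_tail].
rewrite (leq_trans (wt_act_word wS _)) // /wt big_seq1 /= absZ0 !addn0 //.
Qed.

Local Notation wl := (word_length (gens m)).

Lemma spelled_word_length g : spelled g (wl g).
Proof.
have [w wS wE] := hecke_generated g.
by apply: leastP; exists (size w), w.
Qed.

Lemma word_length_le g n : spelled g n -> (wl g <= n)%N.
Proof.
move=> [w [<- wS <-]]; rewrite word_length_nf (leq_trans (wt_act_word wS _)) //.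
by rewrite /wt big_seq1 /= absZ0 !addn0.
Qed.

Lemma word_lengthM g h : (wl (g * h)%g <= wl g + wl h)%N.
Proof. by apply/word_length_le/spelledM; exact: spelled_word_length. Qed.

Lemma word_lengthX g n : (wl (g ^+ n)%g <= n * wl g)%N.
Proof.
elim: n => [|n IHn]; first by rewrite expg0; exact/word_length_le/spelled1.
by rewrite expgS mulSn (leq_trans (word_lengthM _ _)) // leq_add2l.
Qed.

Definition wsum (s : seq Z) : nat := \sum_(y <- s) (absZ y).+1.

Lemma wsum_cons x s : wsum (x :: s) = ((absZ x).+1 + wsum s)%N.
Proof. exact: big_cons. Qed.

Lemma wsum_cat s t : wsum (s ++ t) = (wsum s + wsum t)%N.
Proof. exact: big_cat. Qed.

Lemma wsum_inv s : wsum (inv_seq s) = wsum s.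
Proof.
rewrite /wsum (perm_big (map -%R s)) ?big_map; last by rewrite /inv_seq perm_rev.
by apply: eq_bigr => y _; rewrite absZN.
Qed.

Lemma size_le_wsum s : (size s <= wsum s)%N.
Proof. by elim: s => // x s IHs; rewrite wsum_cons /=; lia. Qed.

Lemma wsum_flatten_nseq s n : wsum (flatten (nseq n s)) = (n * wsum s)%N.
Proof.
by elim: n => [|n IHn] /=; rewrite ?wsum_cat ?IHn ?mulSn //; exact: big_nil.
Qed.

Lemma word_length_Wd s : 0 \notin s -> wl (Wd s) = wsum s.
Proof.
move=> s0; rewrite word_length_nf nf_Wd //; case: s s0 => [|x s] _.
  by rewrite /wt /= big_seq1 absZ0 /wsum big_nil.
rewrite rcons_cons wt_cons wsum_cons -cats1 big_cat big_seq1 absZ0 /=.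
by rewrite addn1 addnS addSn.
Qed.

(* The minimum over the class is the translation length
   [lim wl (g ^+ n) / n]. *)
Lemma word_length_conj_Wd s h : 0 \notin s -> (wsum s <= wl (Wd s ^ h)%g)%N.
Proof.
move=> s0; have bound n : (n * wsum s <= wl h + wl h^-1%g + n * wl (Wd s ^ h)%g)%N.
  rewrite -wsum_flatten_nseq -word_length_Wd ?mem0_flatten_nseq // -WdX.
  have -> : (Wd s ^+ n = h * ((Wd s ^ h) ^+ n * h^-1))%g.
    by rewrite -conjXg conjgE -!mulgA mulgV mulg1 mulKVg.
  apply: leq_trans (word_lengthM _ _) _; rewrite -addnA leq_add2l.
  apply: leq_trans (word_lengthM _ _) _; rewrite addnC leq_add2l.
  exact: word_lengthX.
rewrite leqNgt; apply/negP => lt; have := bound (wl h + wl h^-1%g).+1.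
have := leq_mul (leqnn (wl h + wl h^-1%g).+1) lt; lia.
Qed.

Lemma class_length_Wd s : 0 \notin s ->
  class_length (gens m) (conj_class (Wd s)) = wsum s.
Proof.
move=> s0; apply: least_eq => [|n [_ [h _ <-] <-]]; last exact: word_length_conj_Wd.
exists (Wd s); last exact: word_length_Wd.
by exists 1%g; rewrite ?conjg1.
Qed.

Lemma Wd_expg_neq1 (s : seq Z) n : 0 \notin s -> (0 < size s)%N -> (0 < n)%N ->
  (Wd s ^+ n)%g <> 1%g.
Proof.
move=> s0 ss n0 E; have := word_length_Wd (mem0_flatten_nseq n s0).
rewrite -WdX E wsum_flatten_nseq => E1.
have := word_length_le spelled1; rewrite E1.
by have := size_le_wsum s; rewrite leqn0 muln_eq0; lia.
Qed.


(** * The cyclic words of commutators and their periods *)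

Lemma Zm_opp : - m%:R = m%:R :> Z.
Proof.
apply/eqP; rewrite eq_sym -subr_eq0 opprK -natrD addnn -mul2n pchar_Zp //; lia.
Qed.

Lemma Zm_neq0 : m%:R != 0 :> Z.
Proof. by rewrite valZ_eq0 valZ_nat modn_small; lia. Qed.

Lemma absZm : absZ m%:R = m.
Proof. by rewrite /absZ valZ_nat modn_small; lia. Qed.

Lemma opp_fixZ (z : Z) : z != 0 -> - z = z -> z = m%:R.
Proof.
rewrite valZ_eq0 => z0 /(congr1 (@nat_of_ord _)); rewrite valZ_opp => E.
apply/val_inj => /=.
rewrite valZ_nat modn_small; last by lia.
by have := ltnZ z; move: E; rewrite modn_small; lia.
Qed.

(* [Wd (dbl x)] is the commutator [[b^m, h]] with [h = a b^x_0 a ... a]. *)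
Definition dbl (x : seq Z) : seq Z := m%:R :: x ++ m%:R :: inv_seq x.

Lemma size_dbl (x : seq Z) : size (dbl x) = (2 * (size x).+1)%N.
Proof. by rewrite /= size_cat /= size_inv_seq; lia. Qed.

Lemma mem0_dbl (x : seq Z) : (0 \in dbl x) = (0 \in x).
Proof.
rewrite inE mem_cat inE mem0_inv_seq [0 == _]eq_sym (negPf Zm_neq0) /=.
by rewrite orbb.
Qed.

Lemma wsum_dbl (x : seq Z) : wsum (dbl x) = (2 * (wsum x + m.+1))%N.
Proof. by rewrite wsum_cons wsum_cat wsum_cons wsum_inv absZm; lia. Qed.

Lemma dbl_inj : injective dbl.
Proof.
move=> x y E; have sxy : size x = size y.
  by have := congr1 size E; rewrite !size_dbl; lia.
case: E => /(congr1 (take (size x))).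
by rewrite take_size_cat // sxy take_size_cat.
Qed.

(** Since [- m = m], reversing and negating the cyclic word only moves its leading [m] to the end.
    This is its oddness about that entry. *)
Lemma inv_dbl (x : seq Z) : inv_seq (dbl x) = rot 1 (dbl x).
Proof.
rewrite /dbl -cat1s !inv_seq_cat /inv_seq /= -/(inv_seq _) rev_cons map_rev.
by rewrite -map_rev -/(inv_seq (inv_seq x)) inv_seqK Zm_opp /rot /= drop0 take0 cat_rcons.
Qed.

(** Reading from the other entry [m] exchanges [h] and [h^-1] in the commutator. *)
Lemma rot_dbl (x : seq Z) : rot (size x).+1 (dbl x) = dbl (inv_seq x).
Proof.
have -> : dbl x = (m%:R :: x) ++ (m%:R :: inv_seq x) by [].
by rewrite -[(size x).+1]/(size (m%:R :: x)) rot_size_cat /dbl inv_seqK.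
Qed.

Definition periodic x : bool :=
  has (fun d => rot d (dbl x) == dbl x) (iota 1 (size (dbl x)).-1).

Lemma periodicP (x : seq Z) : reflect
  (exists d, [/\ (0 < d)%N, (d < size (dbl x))%N & rot d (dbl x) = dbl x]) (periodic x).
Proof.
apply: (iffP hasP) => [[d]|[d [d0 dN E]]].
  by rewrite mem_iota add1n prednK ?size_dbl // => /andP[d0 dN] /eqP E; exists d.
by exists d; rewrite ?E // mem_iota add1n prednK ?size_dbl // d0 -size_dbl.
Qed.

Lemma periodic_inv (x : seq Z) : periodic (inv_seq x) = periodic x.
Proof.
suff imp y : periodic y -> periodic (inv_seq y).
  by apply/idP/idP; [rewrite -{2}(inv_seqK x)|]; exact: imp.
move=> /periodicP[d [d0 dN E]]; apply/periodicP; exists d.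
rewrite !size_dbl size_inv_seq -size_dbl; split => //.
by rewrite -rot_dbl rot_rot E.
Qed.

(** The half-turn of [rot_dbl] is then a period. Hence inversion has no fixed point among aperiodic
    words. *)
Lemma periodic_self_inv (x : seq Z) : inv_seq x = x -> periodic x.
Proof.
move=> xx; apply/periodicP; exists (size x).+1.
by rewrite size_dbl rot_dbl xx; split => //; lia.
Qed.

(* As cyclic words, [w = dbl x] and its rotation [dbl y] are both odd,
   [w(-i) = - w(i)], so that twice the shift is a period of [w]. *)
Lemma dbl_rot_cases (x y : seq Z) r : ~~ periodic x -> (r < size (dbl x))%N ->
  dbl y = rot r (dbl x) -> y = x \/ y = inv_seq x.
Proof.
move=> perx rN E; set w := dbl x in E rN *.
have E1 : rotr r (rot 1 w) = rot 1 (rot r w).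
  by rewrite /w -inv_dbl -/w -E -inv_dbl E /inv_seq map_rot rev_rot.
have E2 : rot r (rot r w) = w by apply: (@rot_inj 1); rewrite rot_rot -E1 rotrK.
have sw : size w = (2 * (size x).+1)%N by exact: size_dbl.
case: (posnP r) => [r0|r0]; first by left; apply: dbl_inj; rewrite E r0 rot0.
move: E2; rewrite rot_add_mod; try exact: ltnW.
case: (ltngtP (r + r) (size w)) => rr E2.
- by case/periodicP: perx; exists (r + r)%N; split => //; lia.
- by case/periodicP: perx; exists (r + r - size w)%N; split => //; rewrite -/w; lia.
- by right; apply: dbl_inj; rewrite E -rot_dbl; congr rot; lia.
Qed.

Lemma conj_classJ (G : groupType) (g h : G) : conj_class (g ^ h)%g = conj_class g.
Proof.
apply/seteqP; split=> [_ [z _ <-]|_ [z _ <-]]; first by exists (h * z)%g; rewrite ?conjgM.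
by exists (h^-1 * z)%g; rewrite ?conjgM ?conjgK.
Qed.

Lemma conj_class_rot r (s : seq Z) : conj_class (Wd (rot r s)) = conj_class (Wd s).
Proof. by rewrite /rot Wd_cat -conjg_mulC conj_classJ -Wd_cat cat_take_drop. Qed.

Lemma conj_class_dbl_inv (x : seq Z) :
  conj_class (Wd (dbl (inv_seq x))) = conj_class (Wd (dbl x)).
Proof. by rewrite -rot_dbl conj_class_rot. Qed.

Lemma conj_Wd_rot (x y : seq Z) h : 0 \notin x -> 0 \notin y ->
  (0 < size x)%N -> (0 < size y)%N -> (Wd x ^ h)%g = Wd y ->
  exists2 r, (r < size x)%N & y = rot r x.
Proof.
move=> x0 y0 sx sy E; apply: (@Wd_conj_rot _ _ _ h^-1%g) => //.
by rewrite -E conjgE -!mulgA mulgV mulg1.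
Qed.

Lemma conj_class_dbl (x y : seq Z) : 0 \notin x -> 0 \notin y -> ~~ periodic x ->
  conj_class (Wd (dbl x)) = conj_class (Wd (dbl y)) -> y = x \/ y = inv_seq x.
Proof.
move=> x0 y0 perx E; have : conj_class (Wd (dbl y)) (Wd (dbl y)).
  by exists 1%g; rewrite ?conjg1.
rewrite -E => -[h _ /conj_Wd_rot]; rewrite !mem0_dbl !size_dbl => /(_ x0 y0).
case=> // r rN Er; apply: dbl_rot_cases Er => //; by rewrite size_dbl.
Qed.

(** A root [h] has infinite order because [Wd (dbl x)] has, so it is conjugate to some [Wd v]. Then
    [dbl x] is, up to rotation, the [n]-fold repetition of [v], and [size v] is a proper period. *)
Lemma primitive_dbl (x : seq Z) g : 0 \notin x -> ~~ periodic x ->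
  conj_class (Wd (dbl x)) g -> primitive g.
Proof.
move=> x0 perx [k _ <-] h n n1 _ E.
have d0 : 0 \notin dbl x by rewrite mem0_dbl.
case: (@cyclic_reduction m h (ltnW hm)) => [[N N0 hN]|[l [v [v0 sv El]]]].
  apply: (@Wd_expg_neq1 (dbl x) N) => //; apply: (@conjg_inj _ k).
  by rewrite conjXg -E conj1g -expgM mulnC expgM hN expg1n.
have : (Wd (dbl x) ^ (k * l))%g = Wd (flatten (nseq n v)).
  by rewrite conjgM -E conjXg El WdX.
move/conj_Wd_rot; rewrite mem0_flatten_nseq // => /(_ d0 isT isT).
rewrite size_flatten_nseq muln_gt0 (ltnW n1) sv => /(_ isT)[r rN Er].
move/negP: perx; apply; apply/periodicP; exists (size v).
have Nv : (n * size v = size (dbl x))%N by rewrite -size_flatten_nseq Er size_rot.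
split => //; first by rewrite -Nv ltn_Pmull.
apply: (@rot_inj r); rewrite rot_rot -Er.
case: n n1 {E Er Nv} => // n _; rewrite /= rot_size_cat.
by elim: n => [|n IHn] /=; rewrite ?cats0 // -catA IHn.
Qed.

(** * Reciprocal classes and commutators as doubled words *)

Lemma gen_a_Wd (x : seq Z) : (A * Wd x = ev_tail x * A)%g.
Proof.
elim: x => [|y x IHx]; first by rewrite /Wd /ev_tail !big_nil mulg1 mul1g.
by rewrite Wd_cons ev_tail_cons -!mulgA -IHx !mulgA.
Qed.

Lemma ev_tailV (s : seq Z) : ((ev_tail s)^-1)%g = Wd (inv_seq s).
Proof. by apply: invg_inj; rewrite invgK WdV inv_seqK. Qed.

Lemma gen_bm : (gen_b m ^+ m)%g = bz m%:R.
Proof. exact: gen_bX. Qed.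

Lemma gen_bmV : (gen_b m ^- m)%g = bz m%:R.
Proof. by rewrite gen_bm -bzN Zm_opp. Qed.

Lemma Wd_dbl (x : seq Z) : let h := (ev_tail x * A)%g in
  Wd (dbl x) = (gen_b m ^+ m * h * gen_b m ^- m * h^-1)%g.
Proof.
move=> h; rewrite gen_bmV gen_bm {}/h invgM gen_aV ev_tailV.
by rewrite Wd_cons Wd_cat Wd_cons -gen_a_Wd !mulgA.
Qed.

Lemma bzm_neq1 : bz (m%:R : Z) <> 1%g.
Proof.
rewrite -bz0 => /(congr1 (@nf m)); rewrite /nf !act_bz //= !addr0 => -[E].
by have := Zm_neq0; rewrite E eqxx.
Qed.

(** Conjugating makes the first involution [b^m] and the second [b^m ^ g]. In the normal form of [g]
    the leading power of [b] commutes with [b^m], and the trailing one is removed by conjugating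
    both factors; the inner exponents form the word. *)
Lemma reciprocal_geodesicP C : reciprocal_geodesic m C <->
  exists2 x : seq Z, 0 \notin x & C = conj_class (Wd (dbl x)).
Proof.
split=> [[u [v [[_ [p _ <-]] [_ [q _ <-]] uv ->]]]|[x x0 ->]].
  pose g := (q * p^-1)%g.
  have -> : conj_class ((gen_b m ^+ m) ^ p * (gen_b m ^+ m) ^ q)%g =
      conj_class (gen_b m ^+ m * (gen_b m ^+ m) ^ g)%g.
    by rewrite -(conj_classJ _ p^-1) conjMg /g conjgM conjgK.
  have gp : (q = g * p)%g by rewrite /g mulgKV.
  have {uv} : ((gen_b m ^+ m) ^ g)%g <> (gen_b m ^+ m)%g.
    by move=> E; apply: uv; rewrite gp conjgM E.
  rewrite -(nfK g) gen_bm; have := ok_nf g; case: (nf g) => // l s.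
  have -> : ev (l :: s) = (bz l * ev_tail s)%g by [].
  rewrite conjgM [(bz _ ^ bz l)%g]conjgE -bzD addrC bzD mulKg.
  (* If [g] is a power of [b], the two involutions coincide. *)
  case/lastP: s => [|s z]; first by rewrite /ev_tail big_nil conjg1.
  rewrite /ok inner_rcons => s0 _; exists (inv_seq s); first by rewrite mem0_inv_seq.
  have -> : ev_tail (rcons s z) = (ev_tail s * A * bz z)%g.
    by rewrite /ev_tail -cats1 big_cat big_seq1 /= mulgA.
  rewrite conjgM.
  have {1}-> : bz (m%:R : Z) = (bz m%:R ^ bz z)%g.
    by rewrite conjgE -bzD addrC bzD mulKg.
  rewrite -conjMg conj_classJ; congr conj_class.
  rewrite conjgE invgM gen_aV -gen_a_Wd ev_tailV.
  by rewrite Wd_cons Wd_cat Wd_cons inv_seqK !mulgA.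
have invm : involution (bz (m%:R : Z)).
  split; first exact: bzm_neq1.
  by rewrite bzMn mulr2n -{1}Zm_opp addNr bz0.
have invJ (g h : Gam) : involution g -> involution (g ^ h)%g.
  move=> [g1 g2]; split; last by rewrite -conjXg g2 conj1g.
  by rewrite -(conj1g h) => /conjg_inj.
pose h := (ev_tail x * A)%g.
(* The exponent is [h^-1] since [g ^ h] stands for [h^-1 * g * h]: this makes the second involution
   [h * b^m * h^-1]. *)
exists (bz m%:R), (bz m%:R ^ h^-1)%g; rewrite gen_bm; split.
- by split => //; exists 1%g; rewrite ?conjg1.
- by split; [exact: invJ|exists h^-1%g].
- move=> E; apply: (@Wd_expg_neq1 (dbl x) 1); rewrite ?mem0_dbl // expg1 Wd_dbl.
  rewrite gen_bmV gen_bm -/h -mulgA -mulgA [X in (_ * X)%g](_ : _ = bz m%:R ^ h^-1)%g.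
    by rewrite -E; case: invm.
  by rewrite conjgE invgK.
- by rewrite Wd_dbl gen_bmV gen_bm -/h conjgE invgK !mulgA.
Qed.

Definition intZ (z : Z) : int := if (z <= m)%N then z%:Z else z%:Z - (2 * m)%:Z.

Lemma intZK z : (intZ z)%:~R = z.
Proof.
rewrite /intZ; case: ifP => _; first by rewrite -pmulrn natr_Zp.
rewrite rmorphB /= -!pmulrn natr_Zp pchar_Zp ?subr0 //; lia.
Qed.

Lemma intZ_adm z : z != 0 -> admissible_exp m (intZ z).
Proof.
by rewrite valZ_eq0 /intZ => z0; have := ltnZ z; case: ifP => zm zlt; split; lia.
Qed.

Lemma adm_neq0 l : admissible_exp m l -> l%:~R != 0 :> Z.
Proof.
case: l => n [n0 n1 n2].
  by rewrite -pmulrn valZ_eq0 valZ_nat modn_small; lia.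
rewrite NegzE rmorphN /= oppr_eq0 -pmulrn valZ_eq0 valZ_nat modn_small; lia.
Qed.

Lemma aa_wordP (h : Gam) :
  aa_word h <-> exists2 x : seq Z, 0 \notin x & h = (ev_tail x * A)%g.
Proof.
split=> [[s sadm ->]|[x x0 ->]].
  exists [seq l%:~R | l <- s].
    by apply/mapP => -[l /sadm/adm_neq0 l0 E]; rewrite -E eqxx in l0.
  rewrite /ev_tail big_map; congr (_ * _)%g.
  by apply: eq_bigr => l _; rewrite expgz_bz.
exists [seq intZ z | z <- x].
  by move=> l /mapP[z zx ->]; apply: intZ_adm; apply: contraNneq x0 => <-.
rewrite /ev_tail big_map; congr (_ * _)%g.
by apply: eq_bigr => l _; rewrite expgz_bz intZK.
Qed.

Lemma commutators_of_lengthP t g : commutators_of_length m (2 * t) g <->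
  exists x : seq Z, [/\ 0 \notin x, (wsum x + m.+1 = t)%N & g = Wd (dbl x)].
Proof.
split=> [[[h /aa_wordP[x x0 ->]]]|[x [x0 xt ->]]].
  rewrite -Wd_dbl => -> E; exists x; split => //.
  by move: E; rewrite word_length_Wd ?mem0_dbl // wsum_dbl; lia.
split; last by rewrite word_length_Wd ?mem0_dbl // wsum_dbl xt.
by exists (ev_tail x * A)%g; [apply/aa_wordP; exists x|exact: Wd_dbl].
Qed.

Lemma geodesics_of_lengthP t C :
  geodesics_of_length (reciprocal_geodesic m) (2 * t) C <->
  exists x : seq Z, [/\ 0 \notin x, (wsum x + m.+1 = t)%N & C = conj_class (Wd (dbl x))].
Proof.
split=> [[/reciprocal_geodesicP[x x0 ->]]|[x [x0 xt ->]]].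
  rewrite class_length_Wd ?mem0_dbl // wsum_dbl => E.
  by exists x; split => //; lia.
split; first by apply/reciprocal_geodesicP; exists x.
by rewrite class_length_Wd ?mem0_dbl // wsum_dbl xt.
Qed.

End Lengths.

(** * Counting words and classes *)

Lemma card_set_seq (T : choiceType) (S : set T) (s : seq T) :
  (forall x, S x <-> x \in s) -> card_set S = size (undup s).
Proof.
move=> Ss; have -> : S = [set` [fset x in s]%fset]%classic.
  by apply/seteqP; split => x /=; rewrite inE; apply Ss.
by rewrite /card_set set_fsetK card_fseq.
Qed.

Lemma size_fibers (T U : eqType) (f : T -> U) (s : seq T) :
  size s = (\sum_(c <- undup (map f s)) count (fun x => f x == c) s)%N.
Proof.
under eq_bigr do rewrite -sum1_count big_mkcond /=.
rewrite exchange_big /= -sum1_size; apply: eq_big_seq => x xs.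
rewrite -big_mkcond sum1_count.
rewrite (eq_count (a2 := pred1 (f x))) => [|c]; last by rewrite /= eq_sym.
by rewrite count_uniq_mem ?undup_uniq // mem_undup map_f.
Qed.

Lemma size_double_fibers (T U : eqType) (f : T -> U) (j : T -> T) (s : seq T) :
  uniq s -> (forall x, x \in s -> [/\ j x \in s, j x != x & f (j x) = f x]) ->
  {in s &, forall x y, f x = f y -> y = x \/ y = j x} ->
  size s = (2 * size (undup (map f s)))%N.
Proof.
move=> us Hj Hf; rewrite (size_fibers f) -[X in _ = (2 * X)%N]sum1_size big_distrr /=.
apply: eq_big_seq => c; rewrite mem_undup => /mapP[x xs ->].
have [jxs jx fj] := Hj x xs; rewrite muln1 -size_filter -[2%N]/(size [:: x; j x]).
apply/perm_size/uniq_perm; rewrite ?filter_uniq //= ?inE ?[x == _]eq_sym ?jx //.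
move=> y; rewrite mem_filter !inE; apply/andP/orP => [[/eqP fy ys]|[]/eqP->].
- by case: (Hf x y xs ys) => // ->; [left|right].
- by rewrite eqxx.
- by rewrite fj eqxx.
Qed.

Section Counting.
Variable m : nat.
Hypothesis hm : (2 <= m)%N.
Local Notation Z := 'Z_(2 * m).
Local Notation Gam := (hecke_group m).

(** [wsum] bounds the size of a word, so tuples of size at most [s] exhaust the candidates. *)
Definition words (s : nat) : seq (seq Z) :=
  undup [seq x <- flatten [seq [seq tval t | t <- enum {: n.-tuple Z}] |
                            n <- iota 0 s.+1] | (0 \notin x) && (wsum x == s)].

Lemma mem_words s (x : seq Z) : (x \in words s) = (0 \notin x) && (wsum x == s).
Proof.
rewrite mem_undup mem_filter andb_idr // => /andP[_ /eqP xs].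
apply/flatten_mapP; exists (size x); first by rewrite mem_iota ltnS -xs size_le_wsum.
by apply/mapP; exists (in_tuple x) => //; rewrite mem_enum.
Qed.

Lemma words_uniq s : uniq (words s).
Proof. exact: undup_uniq. Qed.

Lemma size_words0 : size (words 0) = 1%N.
Proof.
rewrite -[1%N]/(size [:: [::] : seq Z]); apply/perm_size/uniq_perm => // [|x].
  exact: words_uniq.
rewrite mem_words inE; case: x => [|y x] /=; first by rewrite /wsum big_nil.
by rewrite wsum_cons andbF.
Qed.

(** The first exponent [l] uses up [absZ l + 1] of the total weight. *)
Lemma size_wordsS s : size (words s.+1) =
  (\sum_(l : Z | (l != 0%R) && (absZ l <= s)) size (words (s - absZ l)))%N.
Proof.
pose L := [seq l <- enum Z | (l != 0%R) && (absZ l <= s)%N].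
have -> : size (words s.+1) = size [seq l :: x | l <- L, x <- words (s - absZ l)].
  apply/perm_size/uniq_perm; first exact: words_uniq.
    apply: allpairs_uniq_dep.
    - by rewrite filter_uniq // enum_uniq.
    - by move=> l _; exact: words_uniq.
    - by move=> [l x] [l' x'] _ _ /= [-> ->].
  move=> x; rewrite mem_words; apply/idP/allpairsPdep.
    case: x => [|l x]; first by rewrite /wsum big_nil.
    rewrite inE negb_or eq_sym wsum_cons => /andP[/andP[l0 x0] /eqP E].
    exists l, x; split => //; last by rewrite mem_words x0; apply/eqP; lia.
    by rewrite mem_filter l0 mem_enum !andbT; lia.
  move=> [l [y [+ + ->]]]; rewrite mem_filter mem_words.
  move=> /andP[/andP[l0 ls] _] /andP[y0 /eqP E].
  by rewrite inE negb_or eq_sym l0 y0 wsum_cons; apply/eqP; lia.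
rewrite size_allpairs_dep sumnE big_map big_filter big_enum_cond /=.
by apply: eq_bigl.
Qed.

(** Source of the coefficients 2 and 1 of the recurrence: below [m] an absolute value is shared by
    [l] and [- l], while [m = - m]. *)
Lemma sum_absZ (V : nmodType) (F : nat -> V) :
  \sum_(l : Z | l != 0) F (absZ l) = \sum_(1 <= j < m) F j *+ 2 + F m.
Proof.
have -> : \sum_(l : Z | l != 0) F (absZ l) =
    \sum_(0 <= i < 2 * m | i != 0%N) F (minn i (2 * m - i)).
  by rewrite -[X in \sum_(0 <= i < X | _) _](ZE hm) big_mkord.
rewrite big_ltn_cond ?muln_gt0 /=; last by lia.
rewrite big_nat_cond (eq_bigl (fun i => (1 <= i < 2 * m)%N)); last first.
  by move=> i /=; lia.
rewrite -big_nat (big_cat_nat (n := m)) /=; [|lia..].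
rewrite [X in _ + X]big_ltn; last by lia.
rewrite addrCA addrC (_ : minn m (2 * m - m) = m); last by lia.
congr (_ + _); under [RHS]eq_bigr do rewrite mulr2n.
rewrite big_split /=; congr (_ + _).
  by apply: eq_big_nat => i ilt; congr F; lia.
rewrite big_nat_rev -{1}[m.+1]add1n big_addn (_ : 2 * m - m = m)%N; last by lia.
by apply: eq_big_nat => i ilt; congr F; lia.
Qed.

(** The word length of the commutator is [2 * (wsum x + m.+1)]; the test guards the truncated
    subtraction. *)
Definition geo_words (t : nat) : seq (seq Z) :=
  if (m < t)%N then words (t - m.+1) else [::].

Lemma mem_geo_words t (x : seq Z) :
  (x \in geo_words t) = (0 \notin x) && (wsum x + m.+1 == t)%N.
Proof.
rewrite /geo_words; case: ifP => mt; last by rewrite in_nil; apply/esym/negbTE; lia.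
by rewrite mem_words; congr (_ && _); lia.
Qed.

Lemma geo_words_uniq t : uniq (geo_words t).
Proof. by rewrite /geo_words; case: ifP => // _; exact: words_uniq. Qed.

Lemma size_geo_words_small t : (t <= m)%N -> size (geo_words t) = 0%N.
Proof. by rewrite /geo_words ltnNge => ->. Qed.

Lemma size_geo_words t : size (geo_words (t + m.+1)) = size (words t).
Proof. by rewrite /geo_words ifT; [congr (size (words _))|]; lia. Qed.

(** The identity fails at [t = 0], where the left side counts the empty word and the right side is
    0. *)
Lemma geo_words_rec t : (0 < t)%N -> size (geo_words (t + m.+1)) =
  (\sum_(1 <= i < m) 2 * size (geo_words (t + i)) + size (geo_words t))%N.
Proof.
case: t => // t _; rewrite size_geo_words size_wordsS.
pose F j := size (geo_words (t.+1 + m - j)).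
have -> : (\sum_(l : Z | (l != 0%R) && (absZ l <= t)) size (words (t - absZ l)) =
    \sum_(l : Z | l != 0%R) F (absZ l))%N.
  rewrite [RHS](bigID (fun l => absZ l <= t)%N) /= [X in _ = (_ + X)%N]big1 ?addn0.
    apply: eq_bigr => l /andP[_ lt]; rewrite /F -size_geo_words.
    by congr (size (geo_words _)); lia.
  move=> l /andP[_ lt]; apply: size_geo_words_small.
  by have := absZ_le hm l; lia.
rewrite (sum_absZ (V := nat)) /F; congr (_ + size (geo_words _))%N; last by lia.
rewrite big_nat_rev; apply: eq_big_nat => i ilt; rewrite mulr2n [RHS]mul2n -[RHS]addnn.
by congr (size (geo_words _) + size (geo_words _))%N; lia.
Qed.

Lemma card_commutators t :
  card_set (commutators_of_length m (2 * t)) = size (geo_words t).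
Proof.
rewrite (card_set_seq (s := [seq Wd (dbl x) | x <- geo_words t])); last first.
  move=> g; rewrite commutators_of_lengthP //; split.
    move=> [x [x0 xt ->]]; apply: (map_f (fun x => Wd (dbl x))).
    by rewrite mem_geo_words x0; apply/eqP.
  by move=> /mapP[x + ->]; rewrite mem_geo_words => /andP[x0 /eqP xt]; exists x.
rewrite undup_id ?size_map // map_inj_in_uniq ?geo_words_uniq // => x y.
rewrite !mem_geo_words => /andP[x0 _] /andP[y0 _] /(congr1 (@nf m)).
by rewrite !nf_Wd ?mem0_dbl // => /rcons_inj/(congr1 fst)/(dbl_inj hm).
Qed.

(** * From words to conjugacy classes *)

Definition geo (x : seq Z) : set Gam := conj_class (Wd (dbl x)).

Lemma geo_inv x : geo (inv_seq x) = geo x.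
Proof. exact: conj_class_dbl_inv. Qed.

Definition aper_words t := [seq x <- geo_words t | ~~ periodic x].
Definition per_words t := [seq x <- geo_words t | periodic x].

Lemma size_aper_per t :
  size (geo_words t) = (size (aper_words t) + size (per_words t))%N.
Proof. by rewrite !size_filter -(count_predC (@periodic m)) addnC. Qed.

Lemma size_aper_words t : size (aper_words t) = (2 * size (undup (map geo (aper_words t))))%N.
Proof.
apply: (@size_double_fibers _ _ _ (@inv_seq m)).
- by rewrite filter_uniq // geo_words_uniq.
- move=> x; rewrite !mem_filter !mem_geo_words => /and3P[perx x0 xt].
  rewrite periodic_inv // mem0_inv_seq wsum_inv // perx x0 xt geo_inv; split => //.
  by apply: contra perx => /eqP/periodic_self_inv; exact.
- move=> x y; rewrite !mem_filter !mem_geo_words => /and3P[perx x0 _] /and3P[_ y0 _].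
  exact: conj_class_dbl.
Qed.

Lemma card_geodesics t :
  card_set (geodesics_of_length (reciprocal_geodesic m) (2 * t)) =
  size (undup (map geo (geo_words t))).
Proof.
apply: card_set_seq => C; rewrite geodesics_of_lengthP //; split.
  move=> [x [x0 xt ->]]; apply: (map_f geo).
  by rewrite mem_geo_words x0; apply/eqP.
by move=> /mapP[x + ->]; rewrite mem_geo_words => /andP[x0 /eqP xt]; exists x.
Qed.

(** Each class of an aperiodic word comes from two such words, and the periodic words add at most
    [size (per_words t)] classes, which count twice on the left. *)
Lemma card_geodesics_le t :
  (2 * card_set (geodesics_of_length (reciprocal_geodesic m) (2 * t)) <=
   size (geo_words t) + size (per_words t))%N.
Proof.
rewrite card_geodesics size_aper_per size_aper_words -addnA addnn -mul2n -mulnDr.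
rewrite leq_mul2l /= -(size_map geo (per_words t)) -size_cat.
apply: uniq_leq_size; first exact: undup_uniq.
move=> C; rewrite mem_undup mem_cat mem_undup => /mapP[x xt ->].
by case: (boolP (periodic x)) => perx; apply/orP; [right|left];
   apply: map_f; rewrite mem_filter perx.
Qed.

(** Aperiodic words give primitive classes, two words to a class; hence at most [size (per_words t)]
    words escape this count. *)
Lemma card_primitive_le t :
  (card_set (geodesics_of_length (primitive_reciprocal_geodesic m) (2 * t)) <=
   card_set (geodesics_of_length (reciprocal_geodesic m) (2 * t)))%N /\
  (size (geo_words t) <= 2 *
   card_set (geodesics_of_length (primitive_reciprocal_geodesic m) (2 * t))
   + size (per_words t))%N.
Proof.
pose pr C := `[< primitive_reciprocal_geodesic m C >].
have -> : card_set (geodesics_of_length (primitive_reciprocal_geodesic m) (2 * t)) =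
    size (undup [seq C <- map geo (geo_words t) | pr C]).
  apply: card_set_seq => C; rewrite mem_filter; split.
    move=> [prC Ct]; apply/andP; split; first exact/asboolP.
    have /geodesics_of_lengthP : geodesics_of_length (reciprocal_geodesic m) (2 * t) C.
      by split => //; case: prC.
    move=> /(_ hm)[x [x0 xt ->]]; apply: (map_f geo).
    by rewrite mem_geo_words x0; apply/eqP.
  case/andP => /asboolP prC /mapP[x xt EC]; split => //.
  have : geodesics_of_length (reciprocal_geodesic m) (2 * t) C; last by case.
  apply/geodesics_of_lengthP => //; exists x.
  by move: xt; rewrite mem_geo_words => /andP[x0 /eqP xt].
split.
  rewrite card_geodesics; apply: uniq_leq_size; first exact: undup_uniq.
  by move=> C; rewrite !mem_undup mem_filter => /andP[].
rewrite size_aper_per leq_add2r size_aper_words leq_mul2l /=.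
apply: uniq_leq_size; first exact: undup_uniq.
move=> C; rewrite !mem_undup => /mapP[x].
rewrite mem_filter => /andP[perx xt] ->; rewrite mem_filter map_f // andbT.
move: (xt); rewrite mem_geo_words => /andP[x0 _].
apply/asboolP; split; first by apply/reciprocal_geodesicP => //; exists x.
by move=> g; exact: primitive_dbl.
Qed.

(** * Counting periodic words *)

Lemma periodic_half (x : seq Z) : periodic x ->
  exists d, [/\ (0 < d)%N, (d <= (size x).+1)%N & rot d (dbl x) = dbl x].
Proof.
move=> /periodicP-/(_ hm)[d [d0 dN E]]; rewrite size_dbl // in dN.
(* Half a turn is [(size x).+1]; a period beyond it is replaced by its complement. *)
case: (leqP d (size x).+1) => dx; first by exists d.
have Er : rotr d (dbl x) = dbl x by rewrite -{1}E rotK.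
exists (size (dbl x) - d)%N; rewrite -/(rotr d (dbl x)) Er.
by rewrite size_dbl //; split => //; lia.
Qed.

Lemma nth_dbl0 (x : seq Z) : nth 0 (dbl x) 0 = m%:R.
Proof. by []. Qed.

Lemma nth_dbl (x : seq Z) i : (i < size x)%N -> nth 0 (dbl x) i.+1 = nth 0 x i.
Proof. by move=> ix; rewrite /= nth_cat ix. Qed.

Lemma nth_dbl_opp (x : seq Z) i : (0 < i)%N -> (i < size (dbl x))%N ->
  nth 0 (dbl x) (size (dbl x) - i) = - nth 0 (dbl x) i.
Proof.
move=> i0 iN; have := congr1 (fun s => nth 0 s (size (dbl x) - i.+1)) (inv_dbl hm x).
have sz : (1 <= size (dbl x))%N by lia.
have lt : (size (dbl x) - i.+1 < size (dbl x))%N by lia.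
have lt2 : (size (dbl x) - (size (dbl x) - i.+1).+1 < size (dbl x))%N by lia.
rewrite nth_rot_mod // {1}/inv_seq nth_rev ?size_map // (nth_map 0) //.
rewrite addn1 -subSn // subSS modn_small; last by rewrite ltn_subrL i0 sz.
by move=> <-; rewrite subKn // ltnW.
Qed.

Lemma nth_dbl_per (x : seq Z) d i : rot d (dbl x) = dbl x -> (d <= size (dbl x))%N ->
  (i < size (dbl x))%N -> nth 0 (dbl x) ((i + d) %% size (dbl x)) = nth 0 (dbl x) i.
Proof. by move=> E dN iN; rewrite -{3}E nth_rot_mod. Qed.

(** The oddness about position 0, shifted by the period [d], is a reflection about [d / 2]. *)
Lemma nth_dbl_refl (x : seq Z) d i : rot d (dbl x) = dbl x -> (d <= size (dbl x))%N ->
  (0 < i)%N -> (i < d)%N -> nth 0 (dbl x) (d - i) = - nth 0 (dbl x) i.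
Proof.
move=> E dN i0 id; rewrite -nth_dbl_opp //; last by lia.
rewrite -[RHS](nth_dbl_per E dN); last by lia.
congr (nth _ _ _); rewrite (_ : _ - _ + d = size (dbl x) + (d - i))%N; last by lia.
by rewrite modnDl modn_small //; lia.
Qed.

(** The first [d - 1] entries of [x] are those of [dbl x] strictly between positions 0 and [d],
    which [nth_dbl_refl] reverses and negates. *)
Lemma periodic_palindrome (x : seq Z) d : rot d (dbl x) = dbl x ->
  (0 < d)%N -> (d <= (size x).+1)%N -> inv_seq (take d.-1 x) = take d.-1 x.
Proof.
move=> E d0 dx; have sz : size (take d.-1 x) = d.-1 by rewrite size_takel //; lia.
apply: (@eq_from_nth _ 0); first by rewrite size_inv_seq.
move=> i; rewrite size_inv_seq sz => id.
rewrite /inv_seq nth_rev size_map sz // (nth_map 0) ?sz; last by lia.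
have dN : (d <= size (dbl x))%N by rewrite size_dbl //; lia.
rewrite !nth_take; [|lia..].
rewrite -[nth 0 x i]nth_dbl; last by lia.
rewrite -[nth 0 x (_ - _)]nth_dbl; last by lia.
by rewrite -(nth_dbl_refl E dN) //; [congr (nth _ _ _)|..]; lia.
Qed.

(** In a word equal to its own inverse the first half weighs as much as the last half. This is the
    source of the exponent [t / 2] in the bound on periodic words. *)
Lemma periodic_prefix_wsum (x : seq Z) d : rot d (dbl x) = dbl x ->
  (0 < d)%N -> (d <= (size x).+1)%N -> (2 * wsum (take d.-1./2 x) <= wsum x)%N.
Proof.
move=> E d0 dx; have := periodic_palindrome E d0 dx; set u := take d.-1 x => uu.
set q := d.-1./2; have qd : (q + q <= d.-1)%N by rewrite addnn /q; lia.
have sz : size u = d.-1 by rewrite size_takel //; lia.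
have -> : take q x = take q u by rewrite /u take_takel //; lia.
have wu : (wsum u <= wsum x)%N by rewrite -[X in (_ <= wsum X)%N](cat_take_drop d.-1 x) wsum_cat leq_addr.
apply: leq_trans wu.
have Et : take q u = inv_seq (drop (size u - q) u).
  by rewrite -{1}uu /inv_seq take_rev size_map map_drop.
have dd : drop (size u - q) u = drop (size u - q - q) (drop q u).
  by rewrite drop_drop; congr drop; lia.
have : (wsum (take q u) <= wsum (drop q u))%N.
  rewrite {1}Et wsum_inv // dd -[X in (_ <= wsum X)%N](cat_take_drop (size u - q - q) (drop q u)).
  by rewrite wsum_cat leq_addl.
by rewrite -[X in (_ -> _ <= wsum X)%N](cat_take_drop q u) wsum_cat; lia.
Qed.

(* Being odd and [d]-periodic, [w = dbl x] also satisfies [w(d - i) = - w(i)]; at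
   [i = d/2] this forces the nonzero value [w(i)] to be [m]. *)
Lemma periodic_prefix_inj (x y : seq Z) d : 0 \notin x -> 0 \notin y ->
  rot d (dbl x) = dbl x -> rot d (dbl y) = dbl y -> (0 < d)%N ->
  (d <= (size x).+1)%N -> size x = size y ->
  take d.-1./2 x = take d.-1./2 y -> x = y.
Proof.
move=> x0 y0 Ex Ey d0 dx sxy Et; apply: (dbl_inj hm).
have sN : size (dbl x) = size (dbl y) by rewrite !size_dbl // sxy.
have dN : (d <= size (dbl x))%N by rewrite size_dbl //; lia.
apply: (@eq_from_nth _ 0) => // i.
have [n] := ubnP i; elim: n i => // n IHn i; rewrite ltnS => i_n iN.
(* From [d] on the period reduces the index; position 0 holds [m]; up to [d.-1./2] the common prefix
   decides; in between the reflection reduces [i] to [d - i], with the midpoint treated apart. *)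
case: (leqP d i) => di.
  have iE : ((i - d + d) %% size (dbl x) = i)%N by rewrite subnK // modn_small.
  have := @nth_dbl_per x d (i - d)%N Ex dN; rewrite iE => ->; last by lia.
  have := @nth_dbl_per y d (i - d)%N Ey; rewrite -sN iE => ->; try lia.
  by apply: IHn; lia.
case: (posnP i) => [->|i0]; first by rewrite !nth_dbl0.
case: (leqP i d.-1./2) => iq.
  have -> : i = i.-1.+1 by lia.
  rewrite !nth_dbl; try lia.
  by have := congr1 (fun s => nth 0 s i.-1) Et; rewrite !nth_take //; lia.
have dNy : (d <= size (dbl y))%N by rewrite -sN.
have := nth_dbl_refl Ex dN i0 di; have := nth_dbl_refl Ey dNy i0 di.
have di2 : (d - i <= i)%N by lia.
case: (ltngtP (d - i) i) => [lt|gt|Ei]; [|by lia|].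
  by rewrite -IHn; [|lia..] => -> /oppr_inj.
rewrite Ei => /esym Eyi /esym Exi; transitivity (m%:R : Z).
  apply: (opp_fixZ hm _ Exi).
  by apply: contraNneq x0 => E0; rewrite -mem0_dbl // -E0 mem_nth.
apply/esym/(opp_fixZ hm _ Eyi).
by apply: contraNneq y0 => E0; rewrite -mem0_dbl // -E0 mem_nth // -sN.
Qed.

(** A periodic word is recovered from its size, a period and its entries up to half that period; the
    three factors bound the choices for each. *)
Lemma size_per_words t :
  (size (per_words t) <= t.+1 * (t.+1 * \sum_(0 <= i < t./2.+1) size (words i)))%N.
Proof.
(* The smallest period in the first half; for periodic words [periodic_half] rules out the default
   0. *)
pose per (x : seq Z) :=
  head 0%N [seq d <- iota 1 (size x).+1 | rot d (dbl x) == dbl x].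
have perP x : periodic x ->
    [/\ (0 < per x)%N, (per x <= (size x).+1)%N & rot (per x) (dbl x) = dbl x].
  move=> /periodic_half[d [d0 dx E]].
  have : per x \in [seq d <- iota 1 (size x).+1 | rot d (dbl x) == dbl x].
    have : d \in [seq d <- iota 1 (size x).+1 | rot d (dbl x) == dbl x].
      by rewrite mem_filter E eqxx mem_iota; lia.
    by rewrite /per; case: [seq _ <- _ | _] => //= a l _; rewrite mem_head.
  by rewrite mem_filter mem_iota => /andP[/eqP-> /andP[-> +]]; rewrite add1n ltnS; split.
pose enc (x : seq Z) := (size x, (per x, take (per x).-1./2 x)).
pose W := flatten [seq words i | i <- iota 0 t./2.+1].
have -> : (\sum_(0 <= i < t./2.+1) size (words i))%N = size W.
  by rewrite size_flatten sumnE /shape !big_map /index_iota subn0.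
pose I := iota 0 t.+1.
have -> : (t.+1 * (t.+1 * size W))%N = size [seq (n, p) | n <- I, p <- [seq (d, w) | d <- I, w <- W]].
  by rewrite !size_allpairs !size_iota.
rewrite -(size_map enc); apply: uniq_leq_size.
  rewrite map_inj_in_uniq ?filter_uniq ?geo_words_uniq // => x y.
  rewrite !mem_filter !mem_geo_words => /and3P[px x0 _] /and3P[py y0 _].
  have [d0 dx Ex] := perP _ px; have [_ _ Ey] := perP _ py.
  move=> [sxy Ed Et]; rewrite -Ed in Et Ey.
  exact: (periodic_prefix_inj x0 y0 Ex Ey).
move=> e /mapP[x + ->]; rewrite mem_filter mem_geo_words => /and3P[px x0 /eqP xt].
have [d0 dx Ex] := perP _ px; have sx := size_le_wsum hm x.
apply: allpairs_f; first by rewrite mem_iota; lia.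
apply: allpairs_f; first by rewrite mem_iota; lia.
apply/flatten_mapP; exists (wsum (take (per x).-1./2 x)).
  rewrite mem_iota leq0n ltnS geq_half_double -mul2n.
  by rewrite /= (leq_trans (periodic_prefix_wsum Ex d0 dx)) // -xt leq_addr.
rewrite mem_words eqxx andbT; apply: contra x0; exact: mem_take.
Qed.

End Counting.

(** * The characteristic polynomial *)

(** Its coefficients are nonnegative, so the root equation [x ^+ m.+1 = hecke_tail m x] is open to
    monotonicity and the triangle inequality. *)
Definition hecke_tail (m : nat) (F : comNzRingType) (x : F) : F :=
  \sum_(1 <= i < m) 2%:R * x ^+ i + 1.

Lemma horner_hecke m (F : comNzRingType) (x : F) :
  (hecke_poly m F).[x] = x ^+ m.+1 - hecke_tail m x.
Proof.
rewrite /hecke_poly !hornerE horner_sum /hecke_tail opprD addrA.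
by congr (_ - _ - _); apply: eq_bigr => i _; rewrite !hornerE.
Qed.

Lemma hecke_rootE m (F : comNzRingType) (x : F) :
  root (hecke_poly m F) x = (x ^+ m.+1 == hecke_tail m x).
Proof. by rewrite /root horner_hecke subr_eq0. Qed.

Lemma size_hecke_tail m (F : comNzRingType) :
  (size (- (\sum_(1 <= i < m) 2%:R *: 'X^i) - 1 : {poly F})%R <= m.+1)%N.
Proof.
rewrite (leq_trans (size_polyD _ _)) // geq_max !size_polyN size_poly1 andbT.
rewrite (leq_trans (size_sum _ _ _)) //; apply/bigmax_leqP_seq => i.
rewrite mem_index_iota => /andP[_ im] _.
by rewrite (leq_trans (size_scale_leq _ _)) // size_polyXn ltnS ltnW.
Qed.

Lemma size_hecke m (F : comNzRingType) : size (hecke_poly m F) = m.+2.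
Proof.
by rewrite /hecke_poly -addrA size_polyDl size_polyXn // ltnS size_hecke_tail.
Qed.

Lemma monic_hecke m (F : comNzRingType) : hecke_poly m F \is monic.
Proof.
rewrite monicE /hecke_poly -addrA lead_coefDl ?lead_coefXn //.
by rewrite size_polyXn ltnS size_hecke_tail.
Qed.

Lemma map_hecke m (F K : comNzRingType) (f : {rmorphism F -> K}) :
  map_poly f (hecke_poly m F) = hecke_poly m K.
Proof.
rewrite /hecke_poly !rmorphB /= map_polyXn rmorph1 rmorph_sum /=.
congr (_ - _ - _); apply: eq_bigr => i _.
by rewrite map_polyZ /= map_polyXn rmorph_nat.
Qed.

(** Multiplication by [X - 1] telescopes the inner sum and leaves a trinomial whose multiple roots
    can be computed. *)
Lemma hecke_factor m (F : comNzRingType) : (0 < m)%N ->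
  ('X - 1) * hecke_poly m F = ('X + 1) * ('X^(m.+1) - 2%:R *: 'X^m + 1).
Proof.
case: m => // m _; rewrite /hecke_poly; elim: m => [|m IHm].
  by rewrite big_nil subr0 -!mul_polyC rmorph_nat; ring.
rewrite big_nat_recr //=.
have -> : ('X - 1) * ('X^(m.+3) - (\sum_(1 <= i < m.+1) 2%:R *: 'X^i + 2%:R *: 'X^(m.+1)) - 1) =
   ('X - 1) * ('X^(m.+2) - \sum_(1 <= i < m.+1) 2%:R *: 'X^i - 1)
   + ('X - 1) * ('X^(m.+3) - 'X^(m.+2) - 2%:R *: 'X^(m.+1)) :> {poly F} by ring.
rewrite IHm -!mul_polyC rmorph_nat !exprS; ring.
Qed.

(* The roots of [X^(m+1) - 2X^m + 1] are simple: a double root would be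
   [2m/(m+1)], whence [2 (2m)^m = (m+1)^(m+1)] and [m] divides [(m+1)^(m+1)]. *)
Lemma hecke_simple_root m (F : numFieldType) (x : F) : (2 <= m)%N ->
  root (hecke_poly m F) x -> (hecke_poly m F)^`().[x] != 0.
Proof.
move=> hm /rootP px; apply/eqP => dpx; have := hecke_factor F (ltnW hm).
set q := 'X^(m.+1) - 2%:R *: 'X^m + 1 => E.
have E0 : (x + 1) * q.[x] = 0.
  have := congr1 (fun p => p.[x]) E; rewrite /= !hornerM px mulr0.
  by rewrite !hornerE.
have E1 : q.[x] + (x + 1) * q^`().[x] = 0.
  have := congr1 (fun p => p^`().[x]) E; rewrite /= !derivM !hornerD !hornerM px dpx.
  by rewrite !poly.derivE !hornerE.
have qx : q.[x] = x ^+ m.+1 - 2 * x ^+ m + 1 by rewrite /q !hornerE.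
have q'x : q^`().[x] = (m.+1)%:R * x ^+ m - 2 * (m%:R * x ^+ m.-1).
  rewrite /q derivD derivB derivZ !derivXn -polyC1 derivC addr0.
  by rewrite hornerD hornerN hornerZ !hornerMn !hornerXn !mulr_natl.
(* A double root at [-1] would force [q.[-1] = 0], whereas the value is 4 or -2 according to the
   parity of [m]. *)
have [x1|x1] := eqVneq (x + 1) 0.
  have {}x1 : x = -1 by apply/eqP; rewrite -subr_eq0 opprK x1.
  move: E1; rewrite x1 addNr mul0r addr0 -x1 qx x1 exprS -signr_odd.
  case: (odd m); rewrite ?expr1 ?expr0 => E4.
    have /eqP : 4%:R = 0 :> F by rewrite -E4; ring.
    by rewrite pnatr_eq0.
  have /eqP : 2%:R = 0 :> F by apply: oppr_inj; rewrite oppr0 -E4; ring.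
  by rewrite pnatr_eq0.
have {}q'x0 : q^`().[x] = 0.
  by apply: (mulfI x1); rewrite mulr0 -[RHS]E1 [q.[x]](mulfI x1 (etrans E0 (esym (mulr0 _)))) add0r.
have {E0 E1}qx0 : q.[x] = 0 by apply: (mulfI x1); rewrite E0 mulr0.
rewrite qx in qx0; rewrite q'x in q'x0.
have x0 : x != 0.
  apply: contra_eq_neq qx0 => ->; rewrite !expr0n (gtn_eqF (ltnW hm)) /= mulr0.
  by rewrite subrr add0r oner_neq0.
have Ex : m.+1%:R * x = (2 * m)%:R.
  apply: (mulIf (expf_neq0 m.-1 x0)); apply/eqP; rewrite -subr_eq0 -[X in _ == X]q'x0.
  have -> : x ^+ m = x * x ^+ m.-1 by rewrite -exprS prednK // ltnW.
  by rewrite natrM; apply/eqP; ring.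
have : (m.+1%:R ^+ m.+1 : F) = (2 * m)%:R ^+ m * 2.
  have E1 : x ^+ m * (2 - x) = 1.
    transitivity (1 - (x ^+ m.+1 - 2 * x ^+ m + 1)); last by rewrite qx0 subr0.
    by rewrite exprS; ring.
  have E2 : m.+1%:R * (2 - x) = 2 :> F.
    by rewrite mulrBr Ex natrM -natr1; ring.
  transitivity (m.+1%:R ^+ m.+1 * (x ^+ m * (2 - x))); first by rewrite E1 mulr1.
  by rewrite -Ex exprMn exprSr -[X in _ = _ * X]E2; ring.
rewrite -!natrX -natrM => /eqP; rewrite eqr_nat => /eqP E3.
have : (m %| m.+1 ^ m.+1)%N.
  by rewrite E3 expnMn mulnAC dvdn_mull // dvdn_exp // ltnW.
have cop : coprime m (m.+1 ^ m.+1) by rewrite coprimeXr // coprimenS.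
by rewrite -[(m.+1 ^ m.+1)%N]mul1n Gauss_dvdl // dvdn1 => /eqP m1; rewrite m1 in hm.
Qed.

(** The derivative at the first root [x] is the product of the other factors there, which vanishes
    when [x] repeats. *)
Lemma uniq_simple_roots (F : idomainType) (r : seq F) :
  (forall x, x \in r -> (\prod_(y <- r) ('X - y%:P))^`().[x] != 0) -> uniq r.
Proof.
elim: r => //= x r IHr Hr; apply/andP; split.
  apply/negP => xr; have := Hr x (mem_head _ _).
  rewrite big_cons derivM hornerD !hornerM derivXsubC hornerXsubC hornerC.
  rewrite subrr mul0r addr0 mul1r.
  by rewrite horner_prod (big_rem x) //= !hornerE subrr mul0r eqxx.
apply: IHr => y yr; have := Hr y; rewrite inE yr orbT => /(_ isT).
rewrite big_cons derivM hornerD !hornerM derivXsubC hornerC mul1r horner_prod.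
rewrite (big_rem y) //= hornerXsubC subrr mul0r add0r.
by apply: contra => /eqP->; rewrite mulr0.
Qed.

(* Lagrange interpolation of [X^j] at the nodes [lam], read off in degree [n]. *)
Lemma sum_lagrange (F : fieldType) n (lam : 'I_n.+1 -> F) j :
  injective lam -> (j <= n)%N ->
  \sum_(i < n.+1) lam i ^+ j / \prod_(k | k != i) (lam i - lam k) = (j == n)%:R.
Proof.
move=> inj jn; pose w i := \prod_(k | k != i) (lam i - lam k).
pose q i := \prod_(k | k != i) ('X - (lam k)%:P).
have w0 i : w i != 0.
  apply/prodf_neq0 => k ki; rewrite subr_eq0.
  by apply: contra ki => /eqP/inj->.
have qE i k : (q i).[lam k] = if k == i then w i else 0.
  case: eqP => [->|/eqP ki]; rewrite /q horner_prod.
    by apply: eq_bigr => l _; rewrite !hornerE.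
  by rewrite (bigD1 k) //= !hornerE subrr mul0r.
have sq i : size (q i) = n.+1.
  rewrite /q -big_filter size_prod_XsubC -sum1_size big_filter sum1_card.
  by rewrite cardC1 card_ord.
have mq i : q i \is monic by exact: monic_prod_XsubC.
have L0 : 'X^j - \sum_i (lam i ^+ j / w i) *: q i = 0.
  apply: (@roots_geq_poly_eq0 _ _ (map lam (enum 'I_n.+1))).
  - apply/allP => x /mapP[k _ ->]; rewrite /root !hornerE horner_sum.
    rewrite (bigD1 k) //= !hornerE qE eqxx divfK // big1 ?addr0 ?subrr // => i ik.
    by rewrite !hornerE qE eq_sym (negPf ik) mulr0.
  - by rewrite map_inj_uniq // enum_uniq.
  - rewrite size_map size_enum_ord (leq_trans (size_polyD _ _)) // geq_max.
    rewrite size_polyXn ltnS jn size_polyN (leq_trans (size_sum _ _ _)) //.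
    by apply/bigmax_leqP => i _; rewrite (leq_trans (size_scale_leq _ _)) // sq.
have := congr1 (fun p : {poly F} => p`_n) L0.
rewrite coefB coefXn coef0 coef_sum => /eqP; rewrite subr_eq0 eq_sym [n == j]eq_sym => /eqP <-.
apply: eq_bigr => i _; rewrite coefZ.
by have := mq i; rewrite monicE /lead_coef sq => /eqP ->; rewrite mulr1.
Qed.

(** * The positive root and its dominance *)

Section Beta.
Variables (R : realType) (m : nat).
Hypothesis hm : (2 <= m)%N.
Implicit Types u v x : R.

Lemma hecke_tail_gt0 x : 0 <= x -> 0 < hecke_tail m x.
Proof.
move=> x0; rewrite ltr_wpDl //; apply: sumr_ge0 => i _.
by rewrite mulr_ge0 // exprn_ge0.
Qed.

(** [hecke_tail m x / x ^+ m.+1] is strictly decreasing, since every exponent in the tail is below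
    [m.+1]; the cross-multiplied form allows [u = 0]. It makes the positive root unique. *)
Lemma hecke_tail_decr u v : 0 <= u -> u < v ->
  u ^+ m.+1 * hecke_tail m v < v ^+ m.+1 * hecke_tail m u.
Proof.
move=> u0 uv; rewrite /hecke_tail !mulrDr !mulr1 !mulr_sumr.
apply: ler_ltD; last by rewrite ltr_pXn2r // nnegrE ltW // (le_lt_trans u0).
rewrite !big_seq; apply: ler_sum => i; rewrite mem_index_iota => /andP[_ im].
rewrite mulrCA [leRHS]mulrCA ler_pM2l //.
have -> : m.+1 = (m.+1 - i + i)%N by lia.
have E (a b c : R) : a * b * c = b * c * a by ring.
rewrite !exprD E [leRHS]E [v ^+ i * _]mulrC ler_wpM2l //; first by rewrite mulr_ge0 // exprn_ge0 // ltW // (le_lt_trans u0).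
by rewrite lerXn2r // ?nnegrE ?ltW // (le_lt_trans u0).
Qed.

Variable beta : R.
Hypotheses (beta_gt0 : 0 < beta) (beta_root : root (hecke_poly m R) beta).

Lemma betaE : beta ^+ m.+1 = hecke_tail m beta.
Proof. by apply/eqP; rewrite -hecke_rootE. Qed.

Lemma hecke_tail_gt_beta x : beta < x -> hecke_tail m x < x ^+ m.+1.
Proof.
move=> bx; have := hecke_tail_decr (ltW beta_gt0) bx; rewrite betaE.
by rewrite mulrC ltr_pM2r // hecke_tail_gt0 // ltW.
Qed.

Lemma hecke_tail_lt_beta x : 0 <= x -> x < beta -> x ^+ m.+1 < hecke_tail m x.
Proof.
move=> x0 xb; have := hecke_tail_decr x0 xb; rewrite betaE.
by rewrite mulrC ltr_pM2l // hecke_tail_gt0 // ltW.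
Qed.

Lemma beta_unique x : 0 < x -> root (hecke_poly m R) x -> x = beta.
Proof.
move=> x0; rewrite hecke_rootE => /eqP E; case: (ltgtP x beta) => // h.
  by have := hecke_tail_lt_beta (ltW x0) h; rewrite E ltxx.
by have := hecke_tail_gt_beta h; rewrite E ltxx.
Qed.

(** With [beta <= 1] the tail at 1 would be at most 1, but it is [2 * m - 1]. *)
Lemma beta_gt1 : 1 < beta.
Proof.
rewrite ltNge; apply/negP => b1.
have : hecke_tail m 1 <= 1 ^+ m.+1 :> R.
  move: b1; rewrite le_eqVlt => /orP[/eqP b1|/hecke_tail_gt_beta/ltW//].
  by rewrite -b1 betaE.
rewrite expr1n /hecke_tail gerDr big_ltn // => /(lt_le_trans _) h.
suff /h : 0 < 2 * 1 ^+ 1 + \sum_(2 <= i < m) 2 * 1 ^+ i :> R by rewrite ltxx.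
rewrite ltr_pwDl ?expr1n ?mulr1 //.
by apply: sumr_ge0 => i _; rewrite mulr_ge0 // exprn_ge0.
Qed.

(** Substituting the root equation into [beta * p'(beta)] leaves a sum with positive
    coefficients. *)
Lemma deriv_hecke_gt0 : 0 < (hecke_poly m R)^`().[beta].
Proof.
rewrite -(pmulr_rgt0 _ beta_gt0).
have -> : beta * (hecke_poly m R)^`().[beta] =
    \sum_(1 <= i < m) 2 * (m.+1 - i)%:R * beta ^+ i + m.+1%:R.
  rewrite /hecke_poly !derivB derivXn linear_sum -polyC1 derivC subr0 hornerD hornerN.
  rewrite hornerMn hornerXn horner_sum.
  rewrite mulrBr -mulr_natl mulrCA -exprS betaE /hecke_tail mulrDr mulr1 addrAC.
  congr (_ + _); rewrite !mulr_sumr -sumrB !big_seq; apply: eq_bigr => i.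
  rewrite mem_index_iota => /andP[i1 im]; rewrite /= derivZ derivXn hornerZ.
  rewrite hornerMn hornerXn natrB; last by lia.
  by rewrite -mulr_natl -[in beta ^+ i](prednK i1) exprS; ring.
rewrite ltr_wpDl ?ltr0n //; apply: sumr_ge0 => i _.
by rewrite !mulr_ge0 ?exprn_ge0 // ltW.
Qed.

(* Equality in [|2z + 1| <= 2|z| + 1] forces [z] to be real and nonnegative. *)
Lemma root_dominated (z : R[i]) : root (hecke_poly m R[i]) z ->
  z != beta%:C%C -> `|z| < beta%:C%C.
Proof.
rewrite hecke_rootE => /eqP Ez.
rewrite real_ltNge ?normr_real ?ger0_real ?ler0c ?(ltW beta_gt0) //.
apply: contra => bz; apply/eqP.
pose r := complex.Re `|z|.
have rE : r%:C%C = `|z| by rewrite RRe_real // ger0_real.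
have br : beta <= r by rewrite -lecR rE.
have tail_r : hecke_tail m `|z| <= `|z| ^+ m.+1.
  have -> : hecke_tail m `|z| = (hecke_tail m r)%:C%C.
    rewrite /hecke_tail rmorphD rmorph1 rmorph_sum /=; congr (_ + _).
    by apply: eq_bigr => i _; rewrite rmorphM rmorphXn rmorph_nat /= rE.
  rewrite -rE -rmorphXn lecR; move: br; rewrite le_eqVlt => /orP[/eqP <-|].
    by rewrite betaE.
  by move/hecke_tail_gt_beta/ltW.
(* Here [hecke_tail m |z|] is at most the modulus of [hecke_tail m z]; bounding the terms of [S] by
   their moduli leaves the inequality for [2 * z + 1]. *)
have le1 : 2 * `|z| + 1 <= `|2 * z + 1|.
  pose S (x : R[i]) := \sum_(2 <= i < m) 2%:R * x ^+ i.
  have tailE (x : R[i]) : hecke_tail m x = (2 * x + 1) + S x.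
    by rewrite /hecke_tail big_ltn // expr1 addrAC.
  rewrite -(lerD2r (S `|z|)) -tailE (le_trans tail_r) // -normrX Ez tailE.
  rewrite (le_trans (ler_normD _ _)) // lerD2l (le_trans (ler_norm_sum _ _ _)) //.
  by apply: ler_sum => i _; rewrite normrM normrX normr_nat.
have : `|2 * z + 1| = `|2 * z| + `|1|.
  by apply/le_anti; rewrite ler_normD normrM normr1 normr_nat.
move=> /normCDeq[t _ [E2]]; rewrite normr1 mul1r => E1.
move: E2; rewrite -E1 mulr1 normrM normr_nat => /(mulfI (_ : 2 != 0 :> R[i])) E2.
have {}E2 : z = r%:C%C by rewrite rE -E2 // pnatr_eq0.
rewrite E2; congr (_%:C)%C; apply: beta_unique; first exact: lt_le_trans br.
rewrite hecke_rootE; apply/eqP/complexI.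
rewrite rmorphXn /= -E2 Ez /hecke_tail rmorphD rmorph1 rmorph_sum /= {1}E2.
by congr (_ + _); apply: eq_bigr => i _; rewrite rmorphM rmorphXn rmorph_nat.
Qed.

End Beta.

Lemma beta_exists (R : realType) m : (2 <= m)%N ->
  exists beta : R, 0 < beta /\ root (hecke_poly m R) beta.
Proof.
move=> hm; have p0 : (hecke_poly m R).[0] < 0.
  rewrite horner_hecke expr0n /= sub0r oppr_lt0; exact: hecke_tail_gt0.
have p2 : 0 <= (hecke_poly m R).[2].
  (* This gives [p(2) = 3], so the root is sought in [[0, 2]]. *)
  have E n : (0 < n)%N -> hecke_tail n (2 : R) = 2 ^+ n.+1 - 3.
    case: n => // n _; elim: n => [|n IHn]; first by rewrite /hecke_tail big_nil; lra.
    rewrite /hecke_tail big_nat_recr //= addrAC -[X in X + _ = _]/(hecke_tail n.+1 2) IHn.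
    by rewrite !exprS; ring.
  by rewrite horner_hecke E ?(ltnW hm) // opprB addrCA subrr addr0.
have [//||x /andP[x0 _] rx] := @poly_ivt R (hecke_poly m R) 0 2.
  by rewrite (ltW p0) p2.
exists x; split => //; rewrite lt_neqAle x0 andbT; apply/eqP => x0'.
by move: rx; rewrite -x0' => /rootP E; rewrite E ltxx in p0.
Qed.

(** * Asymptotics *)

Local Open Scope classical_set_scope.

Lemma exists_sqrt_gt1 (R : rcfType) (x : R) : 1 < x -> exists2 y : R, 1 < y & y ^+ 2 = x.
Proof.
move=> x1; exists (Num.sqrt x); last by rewrite sqr_sqrtr // ltW // (lt_trans ltr01).
by rewrite -sqrtr1 ltr_sqrt // (lt_trans ltr01).
Qed.

Lemma natS_le_expr (R : realFieldType) (x : R) : 1 < x ->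
  exists2 K : R, 0 < K & forall n : nat, n.+1%:R <= K * x ^+ n.
Proof.
move=> x1; have d0 : 0 < x - 1 by rewrite subr_gt0.
(* [K] is chosen with [K * (x - 1) = x], so that each step of the induction gains at least 1. *)
set K := 1 + (x - 1)^-1; exists K; first by rewrite addr_gt0 // invr_gt0.
elim=> [|n IHn]; first by rewrite expr0 mulr1 lerDl invr_ge0 ltW.
have -> : K * x ^+ n.+1 = K * x ^+ n + K * (x - 1) * x ^+ n by rewrite exprS; ring.
rewrite -natr1 lerD // -[leLHS]mulr1 ler_pM // ?exprn_ege1 ?(ltW x1) //.
by rewrite /K mulrDl mul1r mulVf ?gt_eqF // lerDr ltW.
Qed.

Section Asymptotics.
Variables (R : realType) (m : nat).
Hypothesis hm : (2 <= m)%N.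
Variable beta : R.
Hypotheses (beta_gt0 : 0 < beta) (beta_root : root (hecke_poly m R) beta).
Local Notation Z := 'Z_(2 * m).

(** Induction on the first exponent: the root equation says that the weights [beta ^- (absZ l).+1]
    of the nonzero exponents sum to 1, a Kraft equality. *)
Lemma size_words_le s : (size (words m s))%:R <= beta ^+ s.
Proof.
have [n] := ubnP s; elim: n s => // n IHn [|s] sn; first by rewrite size_words0.
have bn0 : beta != 0 by rewrite gt_eqF.
have E : \sum_(l : Z | l != 0) beta ^- absZ l = beta.
  rewrite (sum_absZ hm (fun j => beta ^- j)); apply: (mulfI (expf_neq0 m bn0)).
  rewrite mulrDr mulfV ?expf_neq0 // mulr_sumr -exprSr (betaE beta_root).
  congr (_ + _); rewrite big_nat_rev !big_seq; apply: eq_bigr => i.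
  rewrite mem_index_iota => /andP[i1 im]; rewrite mulrnAr -mulr_natl; congr (_ * _).
  rewrite (_ : _ - _ = m - i)%N; last by lia.
  by rewrite -[in X in X / _](subnKC (ltnW im)) exprD mulfK // expf_neq0.
rewrite size_wordsS // natr_sum exprSr -[X in _ <= _ * X]E mulr_sumr.
rewrite [leRHS](bigID (fun l => absZ l <= s)%N) /=.
rewrite -[leLHS]addr0 lerD //; last first.
  by apply: sumr_ge0 => l _; rewrite mulr_ge0 // ?invr_ge0 exprn_ge0 // ltW.
apply: ler_sum => l /andP[_ ls]; rewrite -expfB_cond; last by rewrite (negPf bn0) add0n.
by apply: IHn; lia.
Qed.

Lemma per_words_cvg0 :
  (fun t : nat => (size (per_words m t))%:R / beta ^+ t) @ \oo --> (0 : R).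
Proof.
have beta1 := beta_gt1 hm beta_gt0 beta_root.
(* With [eta] the eighth root of [beta], the bound [t^3 beta^(t/2)] costs [eta^(4t)] for the
   exponential and [eta^t] for each linear factor, which leaves [eta^(-t)] after division by
   [eta^(8t)]. *)
have [g g1 gE] := exists_sqrt_gt1 beta1; have [h h1 hE] := exists_sqrt_gt1 g1.
have [eta eta1 etaE] := exists_sqrt_gt1 h1.
have betaE : beta = eta ^+ 8 by rewrite -gE -hE -etaE -!exprM.
have eta0 : 0 < eta by exact: lt_trans eta1.
have [K K0 HK] := natS_le_expr eta1.
apply: (@squeeze_cvgr _ _ _ _ (cst 0) (fun t => K ^+ 3 * eta^-1 ^+ t)).
- near=> t; apply/andP; split; first by rewrite divr_ge0 // exprn_ge0 // ltW.
  rewrite ler_pdivrMr ?exprn_gt0 //.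
  have le1 : (size (per_words m t))%:R <=
      t.+1%:R * (t.+1%:R * (t.+1%:R * beta ^+ t./2)) :> R.
    rewrite (le_trans (_ : _ <= (t.+1 * (t.+1 * \sum_(0 <= i < t./2.+1) size (words m i)))%:R)) //.
      by rewrite ler_nat; exact: size_per_words.
    rewrite !natrM !ler_wpM2l // natr_sum.
    rewrite (le_trans (_ : _ <= \sum_(0 <= i < t./2.+1) beta ^+ t./2)) //.
      rewrite !big_seq; apply: ler_sum => i; rewrite mem_index_iota => /andP[_ it].
      rewrite (le_trans (size_words_le i)) // ler_weXn2l ?ltW //; lia.
    rewrite sumr_const_nat subn0 -[leLHS]mulr_natl ler_wpM2r //.
      by rewrite exprn_ge0 // ltW.
    by rewrite ler_nat; lia.
  have le2 : beta ^+ t./2 <= eta ^+ (4 * t).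
    rewrite betaE -exprM ler_weXn2l ?ltW //; lia.
  have -> : K ^+ 3 * eta^-1 ^+ t * beta ^+ t =
      (K * eta ^+ t) * ((K * eta ^+ t) * ((K * eta ^+ t) * eta ^+ (4 * t))).
    have E8 : beta ^+ t = eta ^+ t * (eta ^+ t * (eta ^+ t * (eta ^+ t * eta ^+ (4 * t)))).
      by rewrite betaE -exprM -!exprD; congr (_ ^+ _); lia.
    have a0 : eta ^+ t != 0 by rewrite expf_neq0 // gt_eqF.
    by rewrite E8 exprVn; move: (eta ^+ t) a0 (eta ^+ (4 * t)) => a a0 b; field.
  apply: (le_trans le1).
  have p0 : 0 <= eta ^+ (4 * t) by rewrite exprn_ge0 // ltW.
  have pK : 0 <= K * eta ^+ t by rewrite mulr_ge0 ?exprn_ge0 ?ltW.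
  have pb : 0 <= beta ^+ t./2 by rewrite exprn_ge0 // ltW.
  by do 2 (apply: ler_pM; rewrite ?mulr_ge0 //); apply: ler_pM.
- exact: cvg_cst.
- rewrite -[X in _ --> X](mulr0 (K ^+ 3)); apply: cvgMr; apply: cvg_expr.
  by rewrite ger0_norm ?invr_ge0 ?ltW // invf_lt1.
Unshelve. all: by end_near.
Qed.

(** * The roots and the expansion of the commutator count *)

Lemma hecke_roots : exists lam : 'I_m.+1 -> R[i],
  [/\ injective lam, forall i, root (hecke_poly m R[i]) (lam i),
      lam ord0 = (beta%:C)%C &
      \prod_(k | k != ord0) (lam ord0 - lam k) =
        ((hecke_poly m R)^`().[beta])%:C%C].
Proof.
have [r rE] := closed_field_poly_normal (hecke_poly m R[i]).
rewrite (monicP (monic_hecke _ _)) scale1r in rE.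
have rb : beta%:C%C \in r.
  by rewrite -root_prod_XsubC -rE -(map_hecke _ (real_complex R)) rmorph_root.
have ur : uniq r.
  apply: uniq_simple_roots => x; rewrite -root_prod_XsubC -rE.
  exact: hecke_simple_root.
have sr : size r = m.+1.
  by have := congr1 (size \o (@polyseq _)) rE; rewrite /= size_hecke size_prod_XsubC => -[].
pose s := beta%:C%C :: rem beta%:C%C r.
have rs : perm_eq r s by exact: perm_to_rem.
have ss : size s = m.+1 by rewrite -(perm_size rs).
have us : uniq s by rewrite -(perm_uniq rs).
pose lam (i : 'I_m.+1) := nth 0 s i.
have prodE : hecke_poly m R[i] = \prod_(k < m.+1) ('X - (lam k)%:P).
  by rewrite rE (perm_big s) //= (big_nth 0) ss big_mkord.
exists lam; split => //.
- move=> i j /eqP; rewrite nth_uniq ?ss // => /eqP E; exact/val_inj.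
- move=> i; rewrite rE root_prod_XsubC (perm_mem rs) mem_nth // ss //.
- have := congr1 (fun p : {poly R[i]} => p^`().[beta%:C%C]) prodE.
  rewrite -(map_hecke _ (real_complex R)) deriv_map horner_map /= => ->.
  rewrite [in RHS](bigD1 ord0) //= derivM hornerD !hornerM derivXsubC hornerXsubC hornerC.
  rewrite subrr mul0r addr0 mul1r horner_prod; apply: eq_bigr => k _.
  by rewrite hornerXsubC.
Qed.

Lemma leading_expansion : let e := beta^-1 / (hecke_poly m R)^`().[beta] in
  leading_coefficient m beta e /\
  (fun t : nat => (size (geo_words m t))%:R / beta ^+ t) @ \oo --> e.
Proof.
move=> e; have [lam [lam_inj lam_root lam0 w0E]] := hecke_roots.
pose w i := \prod_(k | k != i) (lam i - lam k).
pose c i := (lam i)^-1 / w i.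
have c0 : c ord0 = e%:C%C by rewrite /c lam0 /w w0E /e rmorphM /= !fmorphV.
have lam_neq0 i : lam i != 0.
  have := lam_root i; rewrite hecke_rootE; apply: contraTneq => ->.
  have -> : hecke_tail m (0 : R[i]) = 1.
    rewrite /hecke_tail big_nat_cond big1 ?add0r // => j /andP[/andP[j1 _] _].
    by rewrite expr0n gtn_eqF // mulr0.
  by rewrite expr0n /= eq_sym oner_neq0.
pose f t := \sum_i c i * lam i ^+ t.
(* Lagrange interpolation supplies the [m+1] initial values: 0 for [t <= m], and 1 at [t = m+1],
   where the only word is empty. *)
have f_small t : (0 < t)%N -> (t <= m.+1)%N -> f t = (t.-1 == m)%:R.
  move=> t0 tm; rewrite -(sum_lagrange lam_inj) ?/f; last by lia.
  apply: eq_bigr => i _; rewrite /c -{1}(prednK t0) exprS.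
  by rewrite mulrA [_ / w i * _]mulrAC mulVf // mul1r mulrC.
have f_rec t : f (t + m.+1)%N = \sum_(1 <= i < m) 2%:R * f (t + i)%N + f t.
  rewrite /f; under [X in _ = X + _]eq_bigr do rewrite mulr_sumr.
  rewrite exchange_big -big_split; apply: eq_bigr => i _ /=.
  have /eqP E := lam_root i; rewrite exprD; move: (lam_root i).
  rewrite hecke_rootE => /eqP ->; rewrite /hecke_tail mulrDr mulr1 mulrDr; congr (_ + _).
  rewrite !mulr_sumr; apply: eq_bigr => j _; rewrite exprD; ring.
have fE t : (0 < t)%N -> (size (geo_words m t))%:R = f t.
  have [n] := ubnP t; elim: n t => // n IHn t; rewrite ltnS => tn t0.
  case: (leqP t m.+1) => tm.
    rewrite f_small //; case: (leqP t m) => tm'.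
      by rewrite size_geo_words_small // (_ : t.-1 == m = false) //; lia.
    have -> : t = (0 + m.+1)%N by lia.
    by rewrite (size_geo_words hm 0) (size_words0 hm) /= eqxx.
  have [u u0 tu] : exists2 u, (0 < u)%N & t = (u + m.+1)%N.
    by exists (t - m.+1)%N; lia.
  rewrite tu f_rec geo_words_rec // natrD natr_sum IHn //; last by lia.
  congr (_ + _); rewrite !big_seq; apply: eq_bigr => i; rewrite mem_index_iota => im.
  by rewrite natrM IHn //; lia.
split.
  exists lam, c; split => // t t3; rewrite card_commutators // fE //; lia.
pose rho i := complex.Re `|lam i|; pose k i := complex.Re `|c i|.
have ReE (z : R[i]) : (complex.Re `|z|)%:C%C = `|z| by rewrite RRe_real // ger0_real.
have rho_lt i : i != ord0 -> rho i < beta.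
  move=> i0; rewrite -ltcR ReE; apply: (root_dominated hm beta_gt0 beta_root (lam_root i)).
  by rewrite -lam0 (inj_eq lam_inj).
have rho_ge0 i : 0 <= rho i by rewrite -ler0c ReE.
have bound t : (0 < t)%N -> `|(size (geo_words m t))%:R - e * beta ^+ t| <=
    \sum_(i | i != ord0) k i * rho i ^+ t.
  move=> t0; rewrite -lecR rmorph_sum /=.
  have -> : (`|(size (geo_words m t))%:R - e * beta ^+ t|)%:C%C =
      `|f t - c ord0 * lam ord0 ^+ t| :> R[i].
    rewrite -fE // c0 lam0 -rmorphXn -rmorphM -(rmorph_nat (real_complex R)) -rmorphB /=.
    by rewrite normc_def /= expr0n /= addr0 sqrtr_sqr.
  rewrite /f (bigD1 ord0) //= addrAC subrr add0r.
  rewrite (le_trans (ler_norm_sum _ _ _)) //; apply: ler_sum => i _.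
  by rewrite normrM normrX rmorphM rmorphXn /= !ReE.
apply/subr_cvg0.
have : (fun t => \sum_(i | i != ord0) k i * (rho i / beta) ^+ t) @ \oo --> (0 : R).
  rewrite [X in _ --> X](_ : _ = \sum_(i < m.+1 | i != ord0) k i * 0); last first.
    by rewrite big1 // => i _; rewrite mulr0.
  apply: cvg_big => [|i i0]; first exact: add_continuous.
  apply: cvgMr; apply: cvg_expr.
  rewrite ger0_norm; last by rewrite divr_ge0 // ltW.
  by rewrite ltr_pdivrMr // mul1r rho_lt.
move=> lim0; apply/norm_cvg0P; apply: (@squeeze_cvgr _ _ _ _ (cst 0) _ _ _ _ _ lim0); last exact: cvg_cst.
near=> t; rewrite normr_ge0 /=.
have bt : 0 < beta ^+ t by rewrite exprn_gt0.
have -> : (size (geo_words m t))%:R / beta ^+ t - e =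
   ((size (geo_words m t))%:R - e * beta ^+ t) / beta ^+ t.
  by rewrite mulrBl mulfK // gt_eqF.
rewrite normrM normfV (gtr0_norm bt) ler_pdivrMr // mulr_suml.
rewrite (le_trans (bound _ _)) //; last first.
  apply: ler_sum => i _; rewrite -mulrA -exprMn divfK // gt_eqF //.
by near: t; exists 1%N.
Unshelve. all: by end_near.
Qed.

End Asymptotics.

Unset Implicit Arguments.

Theorem theoremB (R : realType) (m : nat) (hm : (2 <= m)%N) :
  exists beta e : R,
    [/\ forall x : R, (0 < x /\ root (hecke_poly m R) x) <-> x = beta,
        leading_coefficient m beta e,
        0 < e,
        (fun t : nat =>
           (card_set (geodesics_of_length (reciprocal_geodesic m) (2 * t)%N))%:R
             / beta ^+ t) @ \oo --> e / 2 &
        (fun t : nat =>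
           (card_set (geodesics_of_length
                        (primitive_reciprocal_geodesic m) (2 * t)%N))%:R
             / beta ^+ t) @ \oo --> e / 2].
Proof.
have [beta [b0 br]] := beta_exists R hm.
have [lead geo_lim] := leading_expansion hm b0 br.
set e := beta^-1 / _ in lead geo_lim.
have per_lim := per_words_cvg0 hm b0 br.
pose X t : R := (size (geo_words m t))%:R / beta ^+ t.
pose Y t : R := (size (per_words m t))%:R / beta ^+ t.
(* Both counts are squeezed between [(X - Y) / 2] and [(X + Y) / 2], and [Y] tends to 0. *)
have lo : (fun t => (X t - Y t) / 2) @ \oo --> e / 2.
  by apply: cvgMl; rewrite -[e]subr0; apply: cvgB.
have hi : (fun t => (X t + Y t) / 2) @ \oo --> e / 2.
  by apply: cvgMl; rewrite -[e]addr0; apply: cvgD.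
have bounds t : let P := (card_set (geodesics_of_length
      (primitive_reciprocal_geodesic m) (2 * t)%N))%:R / beta ^+ t in
    let C := (card_set (geodesics_of_length
      (reciprocal_geodesic m) (2 * t)%N))%:R / beta ^+ t in
    [/\ (X t - Y t) / 2 <= P, P <= C & C <= (X t + Y t) / 2].
  have bt : 0 <= (beta ^+ t)^-1 by rewrite invr_ge0 exprn_ge0 // ltW.
  have [PC NP] := card_primitive_le hm t; have CN := card_geodesics_le hm t.
  rewrite /= /X /Y -mulrBl -mulrDl; split; last 1 first.
  - by rewrite mulrAC ler_wpM2r // ler_pdivlMr // mulrC -natrM -natrD ler_nat.
  - by rewrite mulrAC ler_wpM2r // ler_pdivrMr // mulrC lerBlDr -natrM -natrD ler_nat.
  - by rewrite ler_wpM2r // ler_nat.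
exists beta, e; split => //.
- move=> x; split=> [[x0 rx]|-> //]; exact: (beta_unique hm b0 br).
- by rewrite divr_gt0 ?invr_gt0 // (deriv_hecke_gt0 hm b0 br).
- apply: (squeeze_cvgr _ lo hi); apply: nearW => t; have [h1 h2 h3] := bounds t.
  by rewrite (le_trans h1 h2) h3.
- apply: (squeeze_cvgr _ lo hi); apply: nearW => t; have [h1 h2 h3] := bounds t.
  by rewrite h1 (le_trans h2 h3).
Qed.
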